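(* Let $V$ be a JB-algebra with structure group $\mathrm{Str}(V)$ and Lie algebra $\mathfrak{str}(V)$. For a smooth path $\gamma$ in $\mathrm{Str}(V)$ and a smooth vector field $\mu$ along $\gamma$ (so $\mu_t\in T_{\gamma_t}\mathrm{Str}(V)\subset B(V)$), put $X=\gamma^{-1}\gamma'$ and $Y=\gamma^{-1}\mu$, both with values in $\mathfrak{str}(V)$. Then $$D_t\mu=\mu'-\tfrac12\,\gamma\,(XY+YX+X^{\dagger}Y+Y^{\dagger}X-XY^{\dagger}-YX^{\dagger})$$ is a covariant derivative without torsion in $\mathrm{Str}(V)$. Moreover: (a) If $W=L+D\in\mathfrak{str}(V)$ with $L=L_y$ for some $y\in V$ and $D\in\mathrm{Der}(V)$, and $g\in \mathrm{Str}(V)$, then the geodesic $t\mapsto \mathrm{Exp}_g(t\,gW)$ of this connection with initial position $g$ and initial velocity $gW$ is $\gamma_t=g\,e^{t(L-D)}e^{2tD}$. (b) Along this geodesic, parallel transport is explicitly computed as follows: the parallel vector field $\mu$ along $\gamma$ (i.e. $D_t\mu=0$) with initial value $\mu_0\in T_g\mathrm{Str}(V)$ is $$\mu_t=\gamma_t\, e^{-2t\,\mathrm{ad}\,D}\,e^{tM}\,(g^{-1}\mu_0),$$ where $M$ is the bounded linear operator on $\mathfrak{str}(V)=\mathbb L\oplus\mathrm{Der}(V)$ given in block form by $$M=\frac12\begin{pmatrix}\mathrm{ad}\,D&\mathrm{ad}\,L\\-\mathrm{ad}\,L&3\,\mathrm{ad}\,D\end{pmatrix}.$$ (c) If $V$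 is a finite dimensional Euclidean Jordan algebra, then this is the Levi-Civita connection of the left-invariant Riemannian metric on $\mathrm{Str}(V)$ $$\langle A,B\rangle_g=\tfrac12\mathrm{Tr}\big(g^{-1}A\,(g^{-1}B)^{\dagger}+g^{-1}B\,(g^{-1}A)^{\dagger}\big),\qquad g\in\mathrm{Str}(V),\ A,B\in T_g\mathrm{Str}(V),$$ where $\mathrm{Tr}$ is the trace of $B(V)$.
   Context: A JB-algebra is a real Banach space $V$ with a bilinear commutative product $\circ$ and unit $1$ such that $x^2\circ(x\circ y)=x\circ(x^2\circ y)$, $\|x\circ y\|\le\|x\|\|y\|$, $\|x^2\|=\|x\|^2$ and $\|x^2\|\le\|x^2+y^2\|$. $B(V)$ is the algebra of bounded linear operators on $V$ with operator norm, $GL(V)$ its group of invertible elements. $L_xy=x\circ y$, $U_x=2L_x^2-L_{x^2}$. The structure group $\mathrm{Str}(V)$ is the set of $g\in GL(V)$ for which there is $g^*\in GL(V)$ with $U_{gx}=gU_xg^*$ for all $x\in V$; it is an embedded Banach-Lie subgroup of $GL(V)$ whose Lie algebra is $\mathfrak{str}(V)=\mathbb L\oplus\mathrm{Der}(V)$, with $\mathbb L=\{L_x:x\in V\}$ and $\mathrm{Der}(V)=\{D\in B(V): D(x\circ y)=Dx\circ y+x\circ Dy\ \forall x,y\}$. One has $[\mathbb L,\mathbb L]\subset\mathrm{Der}(V)$, $[\mathbb L,\mathrm{Der}(V)]\subset\mathbb L$, $[\mathrm{Der}(V),\mathrm{Der}(V)]\subset\mathrm{Der}(V)$. Tangent spaces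 are identified as $T_g\mathrm{Str}(V)=g\,\mathfrak{str}(V)\subset B(V)$. For $H=L_x+D\in\mathfrak{str}(V)$ put $H^{\dagger}=L_x-D$. $\mathrm{ad}\,A(B)=AB-BA$. ''Covariant derivative without torsion'' means the covariant derivative along paths $D_t\mu=\mu'-\Gamma_\gamma(\gamma',\mu)$ of a torsion-free affine connection on $\mathrm{Str}(V)$, here the one induced by the left-invariant quadratic spray $F_g(gH)=g(H^2+H^{\dagger}H-HH^{\dagger})$, whose polarization is $\Gamma$. In particular $D_t\mu$ is again tangent along $\gamma$, $D_t$ is $\mathbb R$-linear and satisfies the Leibniz rule $D_t(f\mu)=f'\mu+fD_t\mu$, and $D_s\partial_t\Phi=D_t\partial_s\Phi$ for smooth maps $(s,t)\mapsto\Phi(s,t)\in\mathrm{Str}(V)$. Geodesics are the paths with $D_t\gamma'=0$. A finite dimensional Euclidean Jordan algebra is a finite dimensional real unital Jordan algebra for which $(v|w)=\mathrm{Tr}(L_{v\circ w})$ is a positive definite inner product (it is a JB-algebra for its order norm). *)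

(* Defs.v *)
From HB Require Import structures.
From mathcomp Require Import all_boot all_order all_algebra.
From mathcomp Require Import all_classical all_reals all_analysis.

Set Implicit Arguments.
Unset Strict Implicit.
Unset Printing Implicit Defensive.

Import Order.TTheory GRing.Theory Num.Theory.
Import numFieldNormedType.Exports.

Local Open Scope classical_set_scope.
Local Open Scope ring_scope.

Section BoundedOperators.
Variables (R : realType) (W : normedModType R).

Definition bounded_linear (f : W -> W) : Prop :=
  linear f /\ exists M : R, forall x, `|f x| <= M * `|x|.

Definition bop_pred : {pred W -> W} := fun f => `[< bounded_linear f >].

Record bop := Bop { bop_fun :> W -> W ; bop_in : bop_fun \in bop_pred }.

HB.instance Definition _ := [isSub for bop_fun].
HB.instance Definition _ := [Choice of bop by <:].

Lemma bopP (f : bop) : bounded_linear f.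
Proof. by have := bop_in f; rewrite unfold_in => /asboolP. Qed.

Definition mk_bop (f : W -> W) (h : bounded_linear f) : bop :=
  Bop (asboolT h : f \in bop_pred).

Lemma bopE (f g : bop) : (forall x, f x = g x) -> f = g.
Proof. by move=> fg; apply/val_inj/funext. Qed.

Lemma bop_pos (f : bop) :
  exists2 M : R, 0 <= M & forall x, `|f x| <= M * `|x|.
Proof.
have [_ [M fM]] := bopP f; exists `|M| => // x.
by rewrite (le_trans (fM x))// ler_wpM2r// ler_norm.
Qed.

Lemma bop_linear (f : bop) : linear f.
Proof. by have [] := bopP f. Qed.

Lemma bop_submod_closed : submod_closed bop_pred.
Proof.
split.
  apply/asboolP; split; first by move=> a x y; rewrite /= scaler0 addr0.
  by exists 0 => x; rewrite mul0r normr0.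
move=> a f g /asboolP fB /asboolP gB.
have [fl [M fM]] := fB; have [gl [N gN]] := gB.
apply/asboolP; split.
  move=> k x y.
  rewrite -[LHS]/(a *: f (k *: x + y) + g (k *: x + y)) fl gl.
  rewrite -[RHS]/(k *: (a *: f x + g x) + (a *: f y + g y)).
  by rewrite !scalerDr !scalerA (mulrC a k) addrACA.
exists (`|a| * M + N) => x; rewrite -[(_ + _) x]/(a *: f x + g x).
rewrite (le_trans (ler_normD _ _))// mulrDl lerD//.
by rewrite normrZ -mulrA ler_wpM2l.
Qed.

HB.instance Definition _ :=
  GRing.isSubmodClosed.Build R (W -> W)%type bop_pred bop_submod_closed.
HB.instance Definition _ := [SubChoice_isSubLmodule of bop by <:].

Lemma bopDE (f g : bop) x : (f + g) x = f x + g x. Proof. by []. Qed.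
Lemma bopNE (f : bop) x : (- f) x = - f x. Proof. by []. Qed.
Lemma bopZE a (f : bop) x : (a *: f) x = a *: f x. Proof. by []. Qed.
Lemma bop0E x : (0 : bop) x = 0. Proof. by []. Qed.

Lemma bopD (f : bop) x y : f (x + y) = f x + f y.
Proof. by have := bop_linear f 1 x y; rewrite !scale1r. Qed.
Lemma bop0 (f : bop) : f 0 = 0.
Proof. by apply: (addrI (f 0)); rewrite -bopD !addr0. Qed.
Lemma bopZ (f : bop) a x : f (a *: x) = a *: f x.
Proof. by have := bop_linear f a x 0; rewrite !addr0 bop0 addr0. Qed.
Lemma bopN (f : bop) x : f (- x) = - f x.
Proof. by rewrite -scaleN1r bopZ scaleN1r. Qed.
Lemma bopB (f : bop) x y : f (x - y) = f x - f y.
Proof. by rewrite bopD bopN. Qed.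

Definition opnorm (f : bop) : R :=
  inf [set M : R | 0 <= M /\ forall x, `|f x| <= M * `|x|].

Let bnds (f : bop) := [set M : R | 0 <= M /\ forall x, `|f x| <= M * `|x|].

Lemma opnorm_has_inf (f : bop) : has_inf (bnds f).
Proof.
split; first by have [M M0 fM] := bop_pos f; exists M.
by exists 0 => M [].
Qed.

Lemma opnorm_ge0 (f : bop) : 0 <= opnorm f.
Proof. by apply: lb_le_inf; [case: (opnorm_has_inf f)|move=> M []]. Qed.

Lemma opnorm_le (f : bop) M :
  0 <= M -> (forall x, `|f x| <= M * `|x|) -> opnorm f <= M.
Proof. by move=> M0 fM; apply: ge_inf => //; case: (opnorm_has_inf f). Qed.

Lemma opnormP (f : bop) x : `|f x| <= opnorm f * `|x|.
Proof.
have [->|x0] := eqVneq x 0; first by rewrite bop0 !normr0 mulr0.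
have nx : 0 < `|x| by rewrite normr_gt0.
rewrite -ler_pdivrMr//; apply: lb_le_inf.
  by case: (opnorm_has_inf f).
by move=> M [M0 fM]; rewrite ler_pdivrMr.
Qed.

Lemma opnormD (f g : bop) : opnorm (f + g) <= opnorm f + opnorm g.
Proof.
apply: opnorm_le; first by rewrite addr_ge0 ?opnorm_ge0.
move=> x; rewrite bopDE (le_trans (ler_normD _ _))// mulrDl.
by rewrite lerD ?opnormP.
Qed.

Lemma opnormZ a (f : bop) : opnorm (a *: f) = `|a| * opnorm f.
Proof.
have ub b h : opnorm (b *: h) <= `|b| * opnorm h.
  apply: opnorm_le; first by rewrite mulr_ge0 ?opnorm_ge0.
  by move=> x; rewrite bopZE normrZ -mulrA ler_wpM2l ?opnormP.
apply/eqP; rewrite eq_le ub/=.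
have [->|a0] := eqVneq a 0; first by rewrite normr0 mul0r opnorm_ge0.
rewrite -ler_pdivlMl ?normr_gt0// -normfV.
by rewrite (le_trans _ (ub _ _))// scalerA mulVf// scale1r.
Qed.

Lemma opnorm_eq0 (f : bop) : opnorm f = 0 -> f = 0.
Proof.
move=> f0; apply: bopE => x; apply/eqP; rewrite -normr_eq0 eq_le normr_ge0 andbT.
by rewrite (le_trans (opnormP f x))// f0 mul0r.
Qed.

HB.instance Definition _ :=
  Lmodule_isNormed.Build R bop opnormD opnormZ opnorm_eq0.

Lemma bop_normE (f : bop) : `|f| = opnorm f. Proof. by []. Qed.

Lemma bop_normP (f : bop) x : `|f x| <= `|f| * `|x|.
Proof. exact: (opnormP f x). Qed.

Lemma id_bounded_linear : bounded_linear (fun x : W => x).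
Proof. by split=> //; exists 1 => x; rewrite mul1r. Qed.

Lemma comp_bounded_linear (f g : bop) : bounded_linear (fun x => f (g x)).
Proof.
split=> [a x y|]; first by rewrite !bop_linear.
exists (opnorm f * opnorm g) => x; rewrite (le_trans (opnormP _ _))//.
by rewrite -mulrA ler_wpM2l ?opnormP ?opnorm_ge0.
Qed.

Definition bop_one : bop := mk_bop id_bounded_linear.
Definition bop_mul (f g : bop) : bop := mk_bop (comp_bounded_linear f g).

Fact bop_mulA : associative bop_mul. Proof. by move=> f g h; apply: bopE. Qed.
Fact bop_mul1l : left_id bop_one bop_mul.
Proof. by move=> f; apply: bopE. Qed.
Fact bop_mul1r : right_id bop_one bop_mul.
Proof. by move=> f; apply: bopE. Qed.
Fact bop_mulDl : left_distributive bop_mul +%R.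
Proof. by move=> f g h; apply: bopE. Qed.
Fact bop_mulDr : right_distributive bop_mul +%R.
Proof. by move=> f g h; apply: bopE => x; rewrite /= bopD. Qed.

(* Only a possibly trivial ring: W may be the zero space. *)
HB.instance Definition _ := GRing.Zmodule_isPzRing.Build bop
  bop_mulA bop_mul1l bop_mul1r bop_mulDl bop_mulDr.

Lemma bopME (f g : bop) x : (f * g) x = f (g x). Proof. by []. Qed.
Lemma bop1E x : (1 : bop) x = x. Proof. by []. Qed.

Definition bexp (f : bop) : bop :=
  limn (series (fun n : nat => (n`!%:R : R)^-1 *: f ^+ n)).

Definition GL : set bop := [set g | exists h, g * h = 1 /\ h * g = 1].

(* 0 if g is not in GL *)
Definition binv (g : bop) : bop := xget 0 [set h | g * h = 1 /\ h * g = 1].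

End BoundedOperators.

Definition bracket (A : pzRingType) (a b : A) : A := a * b - b * a.

HB.mixin Record isJBAlgebra (R : realType) V & CompleteNormedModule R V := {
  jmul : V -> V -> V ;
  jone : V ;
  jmulC : commutative jmul ;
  jmul1 : left_id jone jmul ;
  jmul_linear : forall x, linear (jmul x) ;
  jordan_id : forall x y,
    jmul (jmul x x) (jmul x y) = jmul x (jmul (jmul x x) y) ;
  jmul_norm : forall x y, `|jmul x y| <= `|x| * `|y| ;
  jsqr_norm : forall x, `|jmul x x| = `|x| ^+ 2 ;
  jsqr_norm_le : forall x y, `|jmul x x| <= `|jmul x x + jmul y y|
}.

#[short(type="jbAlgType")]
HB.structure Definition JBAlgebra (R : realType) :=
  {V of CompleteNormedModule R V & isJBAlgebra R V}.

Arguments jone {R s}.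

Notation "x *j y" := (jmul x y) (at level 40, left associativity).

Section StructureAlgebra.
Variables (R : realType) (V : jbAlgType R).
Implicit Types (x y z : V) (g A B D H : bop V).

Lemma jmulDr x y z : x *j (y + z) = x *j y + x *j z.
Proof. by have := @jmul_linear R V x 1 y z; rewrite !scale1r. Qed.
Lemma jmul0 x : x *j 0 = 0.
Proof. by apply: (addrI (x *j 0)); rewrite -jmulDr !addr0. Qed.
Lemma jmulZr x a y : x *j (a *: y) = a *: (x *j y).
Proof. by have := @jmul_linear R V x a y 0; rewrite jmul0 !addr0. Qed.
Lemma jmulNr x y : x *j (- y) = - (x *j y).
Proof. by rewrite -scaleN1r jmulZr scaleN1r. Qed.
Lemma jmulDl x y z : (x + y) *j z = x *j z + y *j z.
Proof. by rewrite !(jmulC _ z) jmulDr. Qed.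
Lemma jmulNl x y : (- x) *j y = - (x *j y).
Proof. by rewrite !(jmulC _ y) jmulNr. Qed.
Lemma jmulZl a x y : (a *: x) *j y = a *: (x *j y).
Proof. by rewrite !(jmulC _ y) jmulZr. Qed.

Lemma Lop_bounded_linear x : bounded_linear (jmul x).
Proof. by split; [exact: jmul_linear|exists `|x| => y; exact: jmul_norm]. Qed.

Definition Lop x : bop V := mk_bop (Lop_bounded_linear x).

Lemma LopE x y : Lop x y = x *j y. Proof. by []. Qed.
Lemma LopD x y : Lop (x + y) = Lop x + Lop y.
Proof. by apply: bopE => z; rewrite bopDE !LopE jmulDl. Qed.
Lemma LopN x : Lop (- x) = - Lop x.
Proof. by apply: bopE => z; rewrite bopNE !LopE jmulNl. Qed.
Lemma LopZ a x : Lop (a *: x) = a *: Lop x.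
Proof. by apply: bopE => z; rewrite bopZE !LopE jmulZl. Qed.

Definition Uop x : bop V := 2 *: (Lop x * Lop x) - Lop (x *j x).

Definition Str : set (bop V) :=
  [set g | GL g /\
     exists gs, GL gs /\ forall x, Uop (g x) = g * Uop x * gs].

Definition Der : set (bop V) :=
  [set D | forall x y, D (x *j y) = D x *j y + x *j D y].

Definition str_set : set (bop V) :=
  [set H | exists x D, Der D /\ H = Lop x + D].

(* A derivation kills the unit, so H = L_x + D forces x = H 1; the next two
   definitions are therefore the two projections of str(V) = LL (+) Der(V), as
   LpartE and DpartE state. *)
Definition Lpart H : bop V := Lop (H jone).
Definition Dpart H : bop V := H - Lpart H.
Definition dagger H : bop V := Lpart H - Dpart H.

Lemma Lop1 x : Lop x jone = x.
Proof. by rewrite LopE jmulC jmul1. Qed.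

Lemma Der1 D : Der D -> D jone = 0.
Proof.
move=> /(_ jone jone); rewrite (jmulC (D _)) !jmul1 => h.
by apply: (addrI (D jone)); rewrite addr0 -h.
Qed.

Lemma LpartE x D : Der D -> Lpart (Lop x + D) = Lop x.
Proof. by move=> D0; rewrite /Lpart bopDE Lop1 Der1// addr0. Qed.

Lemma DpartE x D : Der D -> Dpart (Lop x + D) = D.
Proof. by move=> D0; rewrite /Dpart LpartE// addrC addKr. Qed.

Lemma daggerE x D : Der D -> dagger (Lop x + D) = Lop x - D.
Proof. by move=> D0; rewrite /dagger DpartE// LpartE. Qed.

Lemma Der_submod_closed : [/\ Der 0, forall D D', Der D -> Der D' -> Der (D + D')
  & forall a D, Der D -> Der (a *: D)].
Proof.
split=> [x y|D D' hD hD' x y|a D hD x y].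
- by rewrite !bop0E jmul0 jmulC jmul0 addr0.
- by rewrite !bopDE hD hD' jmulDl jmulDr addrACA.
- by rewrite !bopZE hD jmulZl jmulZr scalerDr.
Qed.

Lemma Der_bracket D D' : Der D -> Der D' -> Der (bracket D D').
Proof.
move=> hD hD' x y; rewrite /bracket !bopDE !bopNE !bopME hD hD' !bopD !hD !hD'.
rewrite jmulDl jmulDr jmulNl jmulNr.
set a := _ *j y; set b := D' x *j D y; set c := D x *j D' y; set d := x *j _.
set a' := _ *j y; set d' := x *j _.
rewrite !opprD [LHS](AC (2*2*(2*2)) ((1*5)*(4*8)*((2*7)*(3*6)))).
by rewrite /= !subrr !addr0.
Qed.

Lemma bracketLD x D : Der D -> bracket (Lop x) D = - Lop (D x).
Proof.
move=> hD; apply: bopE => y; rewrite /bracket bopDE !bopNE !bopME !LopE hD.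
by rewrite opprD addrCA subrr addr0.
Qed.

Let brDl A B H : bracket (A + B) H = bracket A H + bracket B H.
Proof. by rewrite /bracket mulrDl mulrDr opprD addrACA. Qed.
Let brC A B : bracket A B = - bracket B A.
Proof. by rewrite /bracket opprB. Qed.
Let brDr A B H : bracket H (A + B) = bracket H A + bracket H B.
Proof. by rewrite !(brC H) brDl opprD. Qed.
Let brNl A B : bracket (- A) B = - bracket A B.
Proof. by rewrite /bracket mulNr mulrN opprD. Qed.
Let brNr A B : bracket A (- B) = - bracket A B.
Proof. by rewrite brC brNl -brC. Qed.

Let double0 (W : lmodType R) (u : W) : u + u = 0 -> u = 0.
Proof.
move=> /eqP; rewrite -mulr2n -scaler_nat scaler_eq0 => /orP[|/eqP//].
by rewrite pnatr_eq0.
Qed.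

Let jordan2 x : bracket (Lop (x *j x)) (Lop x) = 0.
Proof.
apply: bopE => y.
by rewrite /bracket bopDE bopNE !bopME !LopE jordan_id subrr.
Qed.

Let jordan_lin x y : bracket (Lop (x *j y)) (Lop x)
  + bracket (Lop (x *j y)) (Lop x) + bracket (Lop (x *j x)) (Lop y) = 0.
Proof.
have := jordan2 (x + y); have := jordan2 (x - y).
rewrite !jmulDl !jmulDr !jmulNl !jmulNr opprK (jmulC y x).
rewrite !LopD !LopN !brDl !brDr !brNl !brNr !jordan2.
set q := bracket _ (Lop x); set p := bracket _ (Lop y).
set q' := bracket _ (Lop y); set p' := bracket _ (Lop x).
rewrite !add0r !oppr0 !addr0 ?opprK => e1 e2.
set u := q + q + p; set v := p' + q' + q'.
have uv : u + v = 0.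
  by rewrite -e2 [RHS](AC (1*2*3) ((2*4*1)*(6*3*5))).
have uv' : - u + v = 0.
  by rewrite -e1 /u !opprD [RHS](AC (1*2*3) ((2*4*1)*(6*3*5))).
apply: double0; rewrite -[RHS]subr0 -{1}uv -uv'.
by rewrite opprD opprK [RHS]addrACA subrr addr0.
Qed.

Let jordan_lin3 x y z : bracket (Lop (x *j y)) (Lop z)
  + bracket (Lop (y *j z)) (Lop x) + bracket (Lop (z *j x)) (Lop y) = 0.
Proof.
have := jordan_lin (x + z) y; have := jordan_lin x y; have := jordan_lin z y.
rewrite !jmulDl !jmulDr (jmulC x z) (jmulC z y) !LopD !brDl !brDr.
set a := bracket _ (Lop z); set b := bracket _ (Lop y).
set c := bracket _ (Lop x); set d := bracket _ (Lop y).
set e := bracket _ (Lop x); set f := bracket _ (Lop z).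
set h := bracket _ (Lop y).
move=> e1 e2 e3.
apply: double0; rewrite -[RHS]e3.
rewrite [RHS](AC ((2*2)*(2*2)*(2*2))
  ((1*5*9)*(4*8*12)*((2*3*10)*(6*7*11)))) /=.
by rewrite e2 e1 !add0r.
Qed.

Lemma Der_bracketL x y : Der (bracket (Lop x) (Lop y)).
Proof.
move=> u v.
have J (a b c d : V) : (a *j b) *j (c *j d) + (b *j c) *j (a *j d)
    + (c *j a) *j (b *j d)
    = c *j (d *j (a *j b)) + a *j (d *j (b *j c)) + b *j (d *j (c *j a)).
  have /(congr1 (fun f : bop V => f d)) := jordan_lin3 a b c.
  rewrite !bopDE !bopNE !bopME !LopE bop0E !(jmulC _ d) => /eqP.
  by rewrite (AC (2*2*2) ((1*3*5)*(2*4*6))) /= -!opprD subr_eq0 => /eqP.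
have : x *j (y *j (u *j v)) + u *j (y *j (x *j v)) + v *j (y *j (x *j u))
     = y *j (x *j (u *j v)) + u *j (x *j (y *j v)) + v *j (x *j (y *j u)).
  rewrite (jmulC x v) (jmulC y v) -!J (jmulC y x) -!addrA.
  congr (_ + _).
  by rewrite addrC (jmulC x u) [X in X + _]jmulC (jmulC u y)
    [X in _ + X]jmulC.
move=> e0; rewrite /bracket !bopDE !bopNE !bopME !LopE [X in _ = X + _]jmulC.
rewrite !jmulDr !jmulNr; move: e0.
set p := _ *j (_ *j (u *j v)); set q := u *j _; set r := v *j _.
set p' := _ *j (_ *j (u *j v)); set q' := u *j _; set r' := v *j _ => e.
have -> : p = p' + q' + r' - r - q by rewrite -e !addrK.
by rewrite [LHS](AC 6 ((3*4)*(2*5)*(1*6))) /= subrr addr0.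
Qed.

Lemma Der_str D : Der D -> str_set D.
Proof.
by move=> hD; exists 0, D; split=> //; apply: bopE => x;
  rewrite bopDE LopE jmulC jmul0 add0r.
Qed.

Lemma Lop_str x : str_set (Lop x).
Proof.
have [D0 _ _] := Der_submod_closed.
by exists x, 0; rewrite addr0.
Qed.

Definition str_pred : {pred bop V} := fun H => `[< str_set H >].

Lemma str_submod_closed : submod_closed str_pred.
Proof.
have [D0 DD DZ] := Der_submod_closed; split.
  exact/asboolP/Der_str.
move=> a A B /asboolP[x [D [hD ->]]] /asboolP[y [D' [hD' ->]]].
apply/asboolP; exists (a *: x + y), (a *: D + D'); split.
  exact/DD/hD'/DZ.
by rewrite LopD LopZ scalerDr addrACA.
Qed.

HB.instance Definition _ :=
  GRing.isSubmodClosed.Build R (bop V) str_pred str_submod_closed.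

(* The Banach space str(V), with the norm of B(V). *)
Record str := StrElt { str_val :> bop V ; str_in : str_val \in str_pred }.

HB.instance Definition _ := [isSub for str_val].
HB.instance Definition _ := [Choice of str by <:].
HB.instance Definition _ := [SubChoice_isSubLmodule of str by <:].

Definition str_norm (H : str) : R := `|str_val H|.

Lemma str_normD (A B : str) : str_norm (A + B) <= str_norm A + str_norm B.
Proof. exact: ler_normD. Qed.
Lemma str_normZ a (A : str) : str_norm (a *: A) = `|a| * str_norm A.
Proof. exact: normrZ. Qed.
Lemma str_norm_eq0 (A : str) : str_norm A = 0 -> A = 0.
Proof. by move=> /normr0_eq0 A0; apply: val_inj. Qed.

HB.instance Definition _ :=
  Lmodule_isNormed.Build R str str_normD str_normZ str_norm_eq0.

Lemma strP (H : str) : str_set H.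
Proof. by have := str_in H; rewrite unfold_in => /asboolP. Qed.

Definition mk_str H (h : str_set H) : str := StrElt (asboolT h : H \in str_pred).

Lemma str_bracket A B : str_set A -> str_set B -> str_set (bracket A B).
Proof.
have [D0 DD DZ] := Der_submod_closed.
move=> [x [D [hD ->]]] [y [D' [hD' ->]]].
rewrite brDl !brDr (bracketLD _ hD') (brC D (Lop y)) (bracketLD _ hD) opprK.
exists (D y - D' x), (bracket (Lop x) (Lop y) + bracket D D'); split.
  by apply: DD; [exact: Der_bracketL|exact: Der_bracket].
by rewrite LopD LopN [LHS](AC (2*2) ((3*2)*(1*4))).
Qed.

Lemma str_Lpart H : str_set (Lpart H). Proof. exact: Lop_str. Qed.

Lemma str_Dpart H : str_set H -> str_set (Dpart H).
Proof. by move=> [x [D [hD ->]]]; rewrite DpartE//; exact: Der_str. Qed.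

Lemma LpartZD a A B : Lpart (a *: A + B) = a *: Lpart A + Lpart B.
Proof. by rewrite /Lpart bopDE bopZE LopD LopZ. Qed.

Lemma str_normE (A : str) : `|A| = `|str_val A|. Proof. by []. Qed.

Lemma bop_mul_norm A B : `|A * B| <= `|A| * `|B|.
Proof.
apply: opnorm_le; first by rewrite mulr_ge0.
move=> x; rewrite bopME (le_trans (bop_normP _ _))// -mulrA ler_wpM2l//.
exact: bop_normP.
Qed.

Lemma Lpart_norm A : `|Lpart A| <= `|A| * `|jone : V|.
Proof.
apply: opnorm_le; first by rewrite mulr_ge0.
move=> x; rewrite LopE (le_trans (jmul_norm _ _))// ler_wpM2r//.
exact: bop_normP.
Qed.

Lemma ad_bounded_linear (A : str) :
  bounded_linear (fun B : str => mk_str (str_bracket (strP A) (strP B))).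
Proof.
split=> [a B C|].
  apply: val_inj => /=.
  rewrite -[RHS]/(a *: bracket (str_val A) (str_val B)
    + bracket (str_val A) (str_val C)).
  rewrite -[LHS]/(bracket (str_val A) (a *: str_val B + str_val C)) /bracket.
  apply: bopE => x.
  rewrite !(bopDE, bopNE, bopZE, bopME) bopD bopZ scalerBr opprD.
  by rewrite [LHS](AC (2*2) ((1*3)*(2*4))).
exists (`|A| + `|A|) => B; rewrite !str_normE /= /bracket.
rewrite (le_trans (ler_normB _ _))// mulrDl lerD ?bop_mul_norm//.
by rewrite mulrC bop_mul_norm.
Qed.

Definition ad (A : str) : bop str := mk_bop (ad_bounded_linear A).

Lemma adE (A B : str) : str_val (ad A B) =
  str_val A * str_val B - str_val B * str_val A. Proof. by []. Qed.

Lemma projL_bounded_linear :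
  bounded_linear (fun H : str => mk_str (str_Lpart H)).
Proof.
split=> [a A B|]; first by apply: val_inj; rewrite /= LpartZD.
by exists `|jone : V| => A; rewrite mulrC !str_normE Lpart_norm.
Qed.

Definition projL : bop str := mk_bop projL_bounded_linear.
Definition projD : bop str := 1 - projL.

Lemma projLE (H : str) : str_val (projL H) = Lpart H. Proof. by []. Qed.
Lemma projDE (H : str) : str_val (projD H) = Dpart H. Proof. by []. Qed.

(* The operator on str(V) = LL (+) Der(V) with the block matrix
     ( a  b )
     ( c  d ) *)
Definition block_op (a b c d : bop str) : bop str :=
  projL * a * projL + projL * b * projD + projD * c * projL
    + projD * d * projD.

End StructureAlgebra.

Section CovariantDerivative.
Variable R : realType.

(* C^n on an open set, for X finite dimensional (it is used for X = R and
   X = R * R only): all iterated directional derivatives of order at most n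
   exist and are continuous. *)
Fixpoint Cn (X E : normedModType R) (n : nat) (U : set X) (f : X -> E) : Prop :=
  (forall p, U p -> {for p, continuous f}) /\
  if n is n'.+1 then
    forall v, (forall p, U p -> derivable f p v) /\ Cn n' U ('D_v f)
  else True.

Definition smooth_on (X E : normedModType R) (U : set X) (f : X -> E) : Prop :=
  forall n, Cn n U f.

Definition open_interval (J : set R) : Prop := open J /\ is_interval J.

(* M is a submanifold of the normed space E with tangent spaces T g, g in M;
   a map into M is smooth when it is smooth as a map into E. *)
Variables (E : normedModType R) (M : set E) (T : E -> set E).
Implicit Types (J : set R) (c mu nu : R -> E).

Definition path_in J c : Prop :=
  [/\ open_interval J, smooth_on J c & forall t, J t -> M (c t)].

Definition field_along J c mu : Prop :=
  smooth_on J mu /\ forall t, J t -> T (c t) (mu t).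

(* D c mu t is the covariant derivative at time t of the field mu along c, and
   Gam g is the symmetric bilinear map on T g given by the connection. That Gam
   is smooth is expressed along smooth curves, in cd_smooth. *)
Record torsion_free_covariant_derivative
    (Gam : E -> E -> E -> E) (D : (R -> E) -> (R -> E) -> R -> E) : Prop := {
  cd_velocity : forall J c, path_in J c -> field_along J c (derive1 c) ;
  cd_sym : forall g A B, M g -> T g A -> T g B -> Gam g A B = Gam g B A ;
  cd_bilinear : forall g a A B C, M g -> T g A -> T g B -> T g C ->
    Gam g (a *: A + B) C = a *: Gam g A C + Gam g B C ;
  cd_bounded : forall g, M g -> exists K : R, forall A B, T g A -> T g B ->
    `|Gam g A B| <= K * `|A| * `|B| ;
  cd_smooth : forall J c mu nu,
    path_in J c -> field_along J c mu -> field_along J c nu ->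
    smooth_on J (fun t => Gam (c t) (mu t) (nu t)) ;
  cd_christoffel : forall J c mu t, path_in J c -> field_along J c mu -> J t ->
    D c mu t = derive1 mu t - Gam (c t) (derive1 c t) (mu t) ;
  cd_field : forall J c mu, path_in J c -> field_along J c mu ->
    field_along J c (D c mu) ;
  cd_linear : forall J c mu nu a t,
    path_in J c -> field_along J c mu -> field_along J c nu -> J t ->
    D c (fun s => a *: mu s + nu s) t = a *: D c mu t + D c nu t ;
  cd_leibniz : forall J c mu (f : R -> R) t,
    path_in J c -> field_along J c mu -> smooth_on J f -> J t ->
    D c (fun s => f s *: mu s) t = derive1 f t *: mu t + f t *: D c mu t ;
  cd_torsion : forall (U : set (R * R)) (Phi : R * R -> E) (s t : R),
    open U -> smooth_on U Phi -> (forall p, U p -> M (Phi p)) -> U (s, t) ->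
    D (fun s' => Phi (s', t)) (fun s' => 'D_(0, 1) Phi (s', t)) s
    = D (fun t' => Phi (s, t')) (fun t' => 'D_(1, 0) Phi (s, t')) t
}.

Definition geodesic (D : (R -> E) -> (R -> E) -> R -> E) J c : Prop :=
  path_in J c /\ forall t, J t -> D c (derive1 c) t = 0.

Definition geodesic_from (D : (R -> E) -> (R -> E) -> R -> E) J c (g A : E) :
    Prop :=
  [/\ geodesic D J c, J 0, c 0 = g & derive1 c 0 = A].

(* The value at time 1 of the geodesic with initial position g and initial
   velocity A, when there is one. *)
Definition geodesic_exp (D : (R -> E) -> (R -> E) -> R -> E) (g A : E) : E :=
  xget 0 [set h | exists J c, [/\ geodesic_from D J c g A, J 1 & c 1 = h]].

Definition parallel (D : (R -> E) -> (R -> E) -> R -> E) J c mu : Prop :=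
  field_along J c mu /\ forall t, J t -> D c mu t = 0.

Record Riemannian_metric (q : E -> E -> E -> R) : Prop := {
  rm_sym : forall g A B, M g -> T g A -> T g B -> q g A B = q g B A ;
  rm_bilinear : forall g a A B C, M g -> T g A -> T g B -> T g C ->
    q g (a *: A + B) C = a * q g A C + q g B C ;
  rm_posdef : forall g A, M g -> T g A -> A != 0 -> 0 < q g A A ;
  rm_smooth : forall J c mu nu,
    path_in J c -> field_along J c mu -> field_along J c nu ->
    smooth_on J (fun t => q (c t) (mu t) (nu t))
}.

Definition Levi_Civita (q : E -> E -> E -> R)
    (Gam : E -> E -> E -> E) (D : (R -> E) -> (R -> E) -> R -> E) : Prop :=
  torsion_free_covariant_derivative Gam D /\
  forall J c mu nu t,
    path_in J c -> field_along J c mu -> field_along J c nu -> J t ->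
    derive1 (fun s => q (c s) (mu s) (nu s)) t
    = q (c t) (D c mu t) (nu t) + q (c t) (mu t) (D c nu t).

End CovariantDerivative.

Section StrConnection.
Variables (R : realType) (V : jbAlgType R).
Implicit Types (g A B : bop V).

(* T_g Str(V) = g str(V) *)
Definition tangent g : set (bop V) :=
  [set A | exists H, str_set H /\ A = g * H].

Definition spray g A : bop V :=
  let H := binv g * A in g * (H * H + dagger H * H - H * dagger H).

Definition Christoffel g A B : bop V :=
  2^-1 *: (spray g (A + B) - spray g A - spray g B).

Definition Dt (c mu : R -> bop V) (t : R) : bop V :=
  let X := binv (c t) * derive1 c t in
  let Y := binv (c t) * mu t in
  derive1 mu t - 2^-1 *: (c t *
    (X * Y + Y * X + dagger X * Y + dagger Y * X - X * dagger Y - Y * dagger X)).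

Definition str_L (y : V) : str V := mk_str (Lop_str y).
Definition str_D (D : bop V) (hD : Der D) : str V := mk_str (Der_str hD).

Definition transport_op (l d : str V) : bop (str V) :=
  2^-1 *: block_op (ad d) (ad l) (- ad l) (3 *: ad d).

(* The trace, computed in the coordinates phi : V -> R^n with inverse psi. *)
Definition op_trace (n : nat) (phi : V -> 'rV[R]_n) (psi : 'rV[R]_n -> V)
    (A : bop V) : R :=
  \tr (lin1_mx (fun u => phi (A (psi u)))).

Definition is_inner_product (q : V -> V -> R) : Prop :=
  [/\ forall v w, q v w = q w v,
      forall a u v w, q (a *: u + v) w = a * q u w + q v w &
      forall v, v != 0 -> 0 < q v v].

Definition trace_form (tr : bop V -> R) (v w : V) : R := tr (Lop (v *j w)).

Definition str_metric (tr : bop V -> R) g A B : R :=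
  2^-1 * tr (binv g * A * dagger (binv g * B) + binv g * B * dagger (binv g * A)).

End StrConnection.

Arguments Str {R} V.
Arguments tangent {R} V.
Arguments spray {R} V.
Arguments Christoffel {R} V.
Arguments Dt {R} V.

(* Main.v *)
Require Import Defs.
From HB Require Import structures.
From mathcomp Require Import all_boot all_order all_algebra.
From mathcomp Require Import all_classical all_reals all_analysis.
From mathcomp Require Import ring lra.

Set Implicit Arguments.
Unset Strict Implicit.
Unset Printing Implicit Defensive.

Import Order.TTheory GRing.Theory Num.Theory.
Import numFieldNormedType.Exports.

Local Open Scope classical_set_scope.
Local Open Scope ring_scope.

(** In the left trivialization X = c^-1 c', Y = c^-1 mu, the covariant derivative is
    c (Y' + ([X, Y] - [X*, Y] - [Y*, X]) / 2), where H* is the dagger of H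
    ([Dt_trivialized], [conn_opE]). It is tangent because X lies in str(V), which is
    closed under brackets and under limits. That X lies in str(V) is obtained by
    differentiating (h x)^2 = h U_x h^-1 (h 1)^2 along a path h in Str(V) through 1
    ([Str_velocity]). Torsion vanishes because the Christoffel map is symmetric and
    mixed partial derivatives commute ([schwarz]), which rests on the mean value
    inequality for functions with values in a normed space.

    Exponentials of elements of str(V) lie in Str(V), by the Jordan identity
    2 U_(z, a o z) = L_a U_z + U_z L_a ([Uop2_Lop], [Str_bexp]). Hence
    c = g e^(t (L - D)) e^(2tD) is a path in Str(V). Since e^(2tD) is an automorphism
    of V, a field along c has the form g e^(t (L - D)) Z e^(2tD) with Z in str(V), and
    its covariant derivative has the same form with Z' - M Z in place of Z
    ([transport_identity]). The velocity of c corresponds to the constant L + D, which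
    M kills, so that c is a geodesic; the parallel fields are the solutions e^(tM) Z_0.
    Uniqueness follows in both cases by exhibiting a combination with derivative zero,
    after the observation that the velocity l + d of any geodesic satisfies d' = 0 and
    l' = 2 [l, d] ([geodesic_unique], [parallel_exp]).

    In finite dimension, H* is the adjoint of H for the trace form
    ([trace_form_adjoint]), so that the metric is the Hilbert-Schmidt product up to
    symmetrization and is positive definite ([trace_str_gt0]). It is compatible with
    the connection because Y |-> ([X, Y] - [X*, Y] - [Y*, X]) / 2 is skew for it
    ([mform_conn_op]). *)

(** * Differentiation of functions with values in a normed space *)

Section LocalExpansion.
Variables (R : realType) (X E : normedModType R).

(** In this form h = 0 needs no separate treatment and quotients disappear, so it
    can be transported along substitutions of the function. *)
Lemma is_deriveP (f : X -> E) (x v : X) (d : E) :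
  is_derive x v f d <-> forall e : R, 0 < e -> \forall h \near (0 : R),
    `|f (h *: v + x) - f x - h *: d| <= e * `|h|.
Proof.
split=> [[df dv] e e0|H].
  have : (fun h : R => h^-1 *: ((f \o shift x) (h *: v) - f x)) @ 0^' --> d.
    by rewrite -dv; exact: df.
  move=> /cvgrPdist_le/(_ e e0); rewrite near_withinE; apply: filterS => h hd.
  have [->|h0] := eqVneq h 0.
    by rewrite !scale0r add0r subr0 subrr !normr0 mulr0.
  have -> : f (h *: v + x) - f x - h *: d =
      - (h *: (d - h^-1 *: ((f \o shift x) (h *: v) - f x))).
    by rewrite (scalerBr h d) scalerA divff// scale1r opprB.
  by rewrite normrN normrZ mulrC ler_wpM2r// hd.
have C : (fun h : R => h^-1 *: ((f \o shift x) (h *: v) - f x)) @ 0^' --> d.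
  apply/cvgrPdist_le => e e0; rewrite near_withinE.
  apply: filterS (H e e0) => h Hh h0.
  have -> : d - h^-1 *: ((f \o shift x) (h *: v) - f x) =
      - (h^-1 *: (f (h *: v + x) - f x - h *: d)).
    by rewrite (scalerBr h^-1 (_ - _)) scalerA mulVf// scale1r opprB.
  by rewrite normrN normrZ normfV mulrC ler_pdivrMr// normr_gt0.
by split; [apply/cvg_ex; exists d|exact: cvg_lim].
Qed.

Lemma is_derive_continuous_line (f : X -> E) (x v : X) (d : E) :
  is_derive x v f d -> (fun h : R => f (h *: v + x)) @ (0 : R) --> f x.
Proof.
move=> /is_deriveP/(_ 1 ltr01) H; apply/cvgrPdist_le => e e0.
have K0 : 0 < 1 + `|d| by rewrite ltr_pwDl.
near=> h; rewrite distrC.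
have -> : f (h *: v + x) - f x = f (h *: v + x) - f x - h *: d + h *: d.
  by rewrite subrK.
rewrite (le_trans (ler_normD _ _))//.
have : `|f (h *: v + x) - f x - h *: d| + `|h *: d| <= (1 + `|d|) * `|h|.
  rewrite mulrDl normrZ (mulrC `|h|) lerD2r//; near: h; exact: H.
move=> /le_trans; apply; rewrite mulrC -ler_pdivlMr//; near: h.
have e1 : 0 < e / (1 + `|d|) by rewrite divr_gt0.
have := @nbhs0_lt R R _ e1; apply: filterS => h /ltW.
Unshelve. all: by end_near. Qed.

Lemma near_line (U : set X) (p v : X) : open U -> U p ->
  \forall h \near (0 : R), U (h *: v + p).
Proof.
move=> oU Up; have : (fun h : R => h *: v + p) @ (0 : R) --> p.
  rewrite -[X in _ --> X]add0r -(scale0r v).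
  by apply: cvgD; [apply: cvgZr_tmp; exact: cvg_id|exact: cvg_cst].
by apply; exact: open_nbhs_nbhs.
Qed.

End LocalExpansion.

Section MeanValue.
Variables (R : realType) (E : normedModType R).

(** For every K > M the bound with K in place of M holds near each point, by the
    definition of the derivative. The supremum c of the x such that the bound holds
    on the whole of [a, x] satisfies it too, and if c < b the local bound at c goes
    beyond c. *)
Lemma mean_value_inequality (f : R -> E) (df : R -> E) (a b M : R) :
  a <= b -> (forall x, a <= x <= b -> is_derive x 1 f (df x)) ->
  (forall x, a <= x <= b -> `|df x| <= M) ->
  `|f b - f a| <= M * (b - a).
Proof.
move=> ab fd dM.
suff H K : M < K -> `|f b - f a| <= K * (b - a).
  apply/ler_addgt0Pl => e e0; have [->|ba] := eqVneq b a.
    by rewrite !subrr normr0 mulr0 addr0 ltW.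
  have ba0 : 0 < b - a by rewrite subr_gt0 lt_neqAle eq_sym ba.
  rewrite (le_trans (H (M + e / (b - a)) _))//.
    by rewrite ltrDl divr_gt0.
  by rewrite mulrDl divfK ?gt_eqF// addrC.
move=> MK.
have loc x : a <= x <= b -> exists2 d, 0 < d & forall y, `|y - x| < d ->
    `|f y - f x| <= K * `|y - x|.
  move=> axb; have KM : 0 < K - M by rewrite subr_gt0.
  have /is_deriveP/(_ _ KM)/nbhs_ballP[d /= d0 H] := fd x axb.
  exists d => // y yx; have := H (y - x).
  rewrite -ball_normE /= sub0r normrN => /(_ yx).
  rewrite [_%:A]mulr1 subrK => le1.
  rewrite -[f y - f x](subrK ((y - x) *: df x)) (le_trans (ler_normD _ _))//.
  have -> : K * `|y - x| = (K - M) * `|y - x| + M * `|y - x| by ring.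
  rewrite lerD//.
  by rewrite normrZ mulrC ler_wpM2r// dM.
pose S := [set x | a <= x <= b /\ forall y, a <= y <= x ->
   `|f y - f a| <= K * (y - a)].
have Sa : S a.
  split=> [|y]; first by rewrite lexx.
  by rewrite -eq_le => /eqP <-; rewrite !subrr normr0 mulr0.
have hS : has_sup S.
  by split; [exists a|exists b => x [/andP[]]].
set c := sup S.
have ac : a <= c by exact: sup_upper_bound.
have cb : c <= b by apply: ge_sup; [exists a|move=> x [/andP[]]].
have acb : a <= c <= b by rewrite ac.
have [d d0 dP] := loc c acb.
have below y : a <= y -> y < c -> `|f y - f a| <= K * (y - a).
  move=> ay yc; have cy0 : 0 < c - y by rewrite subr_gt0.
  have [x [_ Sx]] := sup_adherent cy0 hS.
  by rewrite -/c opprB addrCA subrr addr0 => yx; rewrite Sx// ay ltW.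
have atc : `|f c - f a| <= K * (c - a).
  have [->|ca] := eqVneq c a; first by rewrite !subrr normr0 mulr0.
  have ac' : a < c by rewrite lt_neqAle eq_sym ca.
  pose y := Num.max a (c - d / 2).
  have yc : y < c by rewrite /y gt_max ac' ltrBlDr ltrDl divr_gt0.
  have ay : a <= y by rewrite /y le_max lexx.
  have cy : `|y - c| < d.
    rewrite distrC gtr0_norm ?subr_gt0// ltrBlDr -ltrBlDl /y lt_max.
    by apply/orP; right; rewrite ltrD2l ltrN2 ltr_pdivrMr// mulr_natr mulr2n ltrDl.
  rewrite -[f c](subrK (f y)) -addrA (le_trans (ler_normD _ _))//.
  have -> : K * (c - a) = K * (c - y) + K * (y - a) by ring.
  rewrite lerD ?below//.
  by rewrite distrC (le_trans (dP y cy))// distrC gtr0_norm ?subr_gt0.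
have [->//|cb'] := eqVneq b c.
have cb0 : c < b by rewrite lt_neqAle eq_sym cb'.
pose z := Num.min b (c + d / 2).
have cz : c < z by rewrite /z lt_min cb0 ltrDl divr_gt0.
have Sz : S z.
  split; first by rewrite (le_trans ac (ltW cz)) /z ge_min lexx.
  move=> y /andP[ay yz]; have [yc|] := ltP y c; first exact: below.
  rewrite le_eqVlt => /predU1P[<-//|cy].
  have yd : `|y - c| < d.
    rewrite gtr0_norm ?subr_gt0// ltrBlDr addrC (le_lt_trans yz)// /z gt_min.
    by apply/orP; right; rewrite ltrD2l ltr_pdivrMr// mulr_natr mulr2n ltrDl.
  rewrite -[f y](subrK (f c)) -addrA (le_trans (ler_normD _ _))//.
  have -> : K * (y - a) = K * (y - c) + K * (c - a) by ring.
  rewrite lerD//.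
  by rewrite (le_trans (dP y yd))// gtr0_norm ?subr_gt0.
have := sup_upper_bound hS Sz; rewrite -/c leNgt => /negP; rewrite cz.
by [].
Qed.

(** All the uniqueness statements below, for exponentials, geodesics and parallel
    fields, exhibit a combination of the unknown with derivative zero. *)
Lemma derive0_constant (J : set R) (f : R -> E) : is_interval J ->
  (forall t, J t -> is_derive t 1 f 0) -> forall s t, J s -> J t -> f s = f t.
Proof.
move=> iJ fd s t; wlog st : s t / s <= t => [H Js Jt|Js Jt].
  by have [|/ltW] := leP s t => ?; [|apply/esym]; exact: H.
have Jx x : s <= x <= t -> J x by exact: iJ.
apply/esym/eqP; rewrite -subr_eq0 -normr_le0.
rewrite (le_trans (@mean_value_inequality f (fun=> 0) s t 0 st _ _))//.
- by move=> x /Jx; exact: fd.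
- by rewrite normr0.
- by rewrite mul0r.
Qed.

End MeanValue.

(** * Deciding linear identities in a module *)

Section LinearCombination.
Variables (R : comNzRingType) (M : lmodType R).

(** Formal linear combinations of atoms. An identity between two of them holds in
    every module as soon as the coefficients of each atom agree. *)
Inductive lexp := LAtom of nat | LZero | LAdd of lexp & lexp | LOpp of lexp
  | LScale of R & lexp.

Fixpoint leval (env : seq M) (e : lexp) : M :=
  match e with
  | LAtom i => nth 0 env i
  | LZero => 0
  | LAdd e1 e2 => leval env e1 + leval env e2
  | LOpp e1 => - leval env e1
  | LScale a e1 => a *: leval env e1
  end.

(** [None] stands for the coefficient zero. It keeps the scalar equations that
    remain to be checked free from the atoms that do not occur. *)
Fixpoint lcoef (e : lexp) (j : nat) : option R :=
  match e with
  | LAtom i => if i == j then Some 1 else None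
  | LZero => None
  | LAdd e1 e2 =>
    match lcoef e1 j, lcoef e2 j with
    | Some a, Some b => Some (a + b)
    | Some a, None => Some a
    | None, o => o
    end
  | LOpp e1 => if lcoef e1 j is Some a then Some (- a) else None
  | LScale a e1 => if lcoef e1 j is Some b then Some (a * b) else None
  end.

Lemma leval_sum (env : seq M) (e : lexp) :
  leval env e = \sum_(i < size env) odflt 0 (lcoef e i) *: nth 0 env i.
Proof.
elim: e => [i||e1 IH1 e2 IH2|e IH|a e IH] /=.
- have [ilt|ige] := ltnP i (size env).
    rewrite (bigD1 (Ordinal ilt))//= eqxx scale1r big1 ?addr0// => j ji.
    by rewrite ifN ?scale0r//; apply: contra ji => /eqP ij; exact/eqP/val_inj.
  rewrite nth_default// big1// => j _; rewrite ifN ?scale0r//.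
  by apply/negP => /eqP ij; move: (ltn_ord j); rewrite -ij ltnNge ige.
- by rewrite big1// => j _; rewrite scale0r.
- rewrite IH1 IH2 -big_split; apply: eq_bigr => j _.
  by case: (lcoef e1 j) (lcoef e2 j) => [b|] [b'|] /=;
    rewrite ?scalerDl ?scale0r ?addr0 ?add0r.
- rewrite IH -sumrN; apply: eq_bigr => j _.
  by case: (lcoef e j) => [b|] /=; rewrite ?scaleNr ?scale0r ?oppr0.
- rewrite IH scaler_sumr; apply: eq_bigr => j _.
  by case: (lcoef e j) => [b|] /=; rewrite ?scale0r ?scaler0 ?scalerA.
Qed.

Fixpoint leq_coef (n : nat) (e1 e2 : lexp) : Prop :=
  if n is n'.+1 then
    odflt 0 (lcoef e1 n') = odflt 0 (lcoef e2 n') /\ leq_coef n' e1 e2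
  else True.

Lemma leval_eq (env : seq M) (e1 e2 : lexp) :
  leq_coef (size env) e1 e2 -> leval env e1 = leval env e2.
Proof.
move=> H; rewrite !leval_sum; apply: eq_bigr => j _; congr (_ *: _).
move: (nat_of_ord j) (ltn_ord j) => {}j; elim: (size env) H => //= n IH [h /IH{}IH].
by rewrite ltnS leq_eqVlt => /predU1P[->|].
Qed.

End LinearCombination.

Ltac lmod_env M t env :=
  lazymatch t with
  | (?a + ?b)%R => let env := lmod_env M a env in lmod_env M b env
  | (- ?a)%R => lmod_env M a env
  | (_ *: ?a)%R => lmod_env M a env
  | 0%R => env
  | _ => let r := lazymatch env with
         | context [t :: _] => env
         | _ => constr:((t : M) :: env)
         end in r
  end.

Ltac lmod_index t env :=
  lazymatch env with
  | t :: _ => constr:(O)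
  | _ :: ?e => let n := lmod_index t e in constr:(S n)
  end.

Ltac lmod_reify R t env :=
  lazymatch t with
  | (?a + ?b)%R => let a' := lmod_reify R a env in
      let b' := lmod_reify R b env in constr:(LAdd a' b')
  | (- ?a)%R => let a' := lmod_reify R a env in constr:(LOpp a')
  | (?k *: ?a)%R => let a' := lmod_reify R a env in constr:(@LScale R k a')
  | 0%R => constr:(@LZero R)
  | _ => let n := lmod_index t env in constr:(@LAtom R n)
  end.

(** Proves an equality of linear combinations in the module [M] over the field [R]
    by comparing coefficients. *)
Ltac lmod_over R M :=
  lazymatch goal with
  | |- ?a = ?b =>
    let env := lmod_env M a (@nil M) in
    let env := lmod_env M b env in
    let a' := lmod_reify R a env in
    let b' := lmod_reify R b env in
    refine (@leval_eq R M env a' b' _);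
    cbn [leq_coef lcoef size odflt oapp]; rewrite /=;
    repeat split; try (by field)
  end.

(** * Smooth maps *)

Section BoundedBilinear.
Variables (R : realType) (E F G : normedModType R).

Definition bounded_bilinear (b : E -> F -> G) : Prop :=
  [/\ forall y, linear (b^~ y), forall x, linear (b x) &
      exists K : R, forall x y, `|b x y| <= K * `|x| * `|y|].

Variables (b : E -> F -> G) (bb : bounded_bilinear b).

Lemma bbDl x x' y : b (x + x') y = b x y + b x' y.
Proof. by have [/(_ y 1 x x') h _ _] := bb; rewrite !scale1r in h. Qed.

Lemma bbDr x y y' : b x (y + y') = b x y + b x y'.
Proof. by have [_ /(_ x 1 y y') h _] := bb; rewrite !scale1r in h. Qed.

Lemma bb0l y : b 0 y = 0.
Proof. by apply: (addrI (b 0 y)); rewrite -bbDl !addr0. Qed.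

Lemma bb0r x : b x 0 = 0.
Proof. by apply: (addrI (b x 0)); rewrite -bbDr !addr0. Qed.

Lemma bbZl a x y : b (a *: x) y = a *: b x y.
Proof. by have [/(_ y a x 0) h _ _] := bb; rewrite bb0l !addr0 in h. Qed.

Lemma bbZr a x y : b x (a *: y) = a *: b x y.
Proof. by have [_ /(_ x a y 0) h _] := bb; rewrite bb0r !addr0 in h. Qed.

Lemma bbBl x x' y : b (x - x') y = b x y - b x' y.
Proof. by rewrite bbDl -scaleN1r bbZl scaleN1r. Qed.

Lemma bbBr x y y' : b x (y - y') = b x y - b x y'.
Proof. by rewrite bbDr -scaleN1r bbZr scaleN1r. Qed.

Lemma bb_bound : exists2 K : R, 0 < K & forall x y, `|b x y| <= K * `|x| * `|y|.
Proof.
have [_ _ [K bK]] := bb; exists (`|K| + 1); first by rewrite ltr_wpDl.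
move=> x y; rewrite (le_trans (bK x y))// !ler_wpM2r//.
by rewrite (le_trans (ler_norm K))// lerDl.
Qed.

Lemma cvg_bilin (T : Type) (S : set_system T) {FS : Filter S}
    (u : T -> E) (w : T -> F) (x : E) (y : F) :
  u @ S --> x -> w @ S --> y -> (fun t => b (u t) (w t)) @ S --> b x y.
Proof.
move=> ux wy; have [K K0 bK] := bb_bound.
have H : (fun t => K * `|x - u t| * `|w t| + K * `|x| * `|y - w t|) @ S
    --> (0 : R).
  have -> : (0 : R) = K * 0 * `|y| + K * `|x| * 0 by rewrite !(mulr0, mul0r) addr0.
  apply: cvgD; apply: cvgM.
  - apply: cvgM; first exact: cvg_cst.
    apply/norm_cvg0P; rewrite -(subrr x); apply: cvgB => //; exact: cvg_cst.
  - exact: cvg_norm.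
  - exact: cvg_cst.
  - apply/norm_cvg0P; rewrite -(subrr y); apply: cvgB => //; exact: cvg_cst.
apply/cvgrPdist_le => e e0.
move/cvgrPdist_le : H => /(_ e e0); apply: filterS => t.
rewrite sub0r normrN => /(le_trans (ler_norm _)) le_e.
have -> : b x y - b (u t) (w t) = b (x - u t) (w t) + b x (y - w t).
  by rewrite bbBl bbBr [RHS]addrC addrA subrK.
by rewrite (le_trans (ler_normD _ _))// (le_trans _ le_e)// lerD.
Qed.

Lemma is_derive_bilin (X : normedModType R) (f : X -> E) (g : X -> F)
    (p v : X) (df : E) (dg : F) :
  is_derive p v f df -> is_derive p v g dg ->
  is_derive p v (fun q => b (f q) (g q)) (b df (g p) + b (f p) dg).
Proof.
move=> fd gd.
have gc := is_derive_continuous_line gd.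
have qf : (fun h : R => h^-1 *: ((f \o shift p) (h *: v) - f p)) @ 0^' --> df.
  by have [d <-] := fd; exact: d.
have qg : (fun h : R => h^-1 *: ((g \o shift p) (h *: v) - g p)) @ 0^' --> dg.
  by have [d <-] := gd; exact: d.
set q := (fun p => b (f p) (g p)).
have C : (fun h : R => h^-1 *: ((q \o shift p) (h *: v) - q p)) @ 0^' -->
    b df (g p) + b (f p) dg.
  have -> : (fun h : R => h^-1 *: ((q \o shift p) (h *: v) - q p)) =
     (fun h : R => b (h^-1 *: ((f \o shift p) (h *: v) - f p)) (g (h *: v + p))
       + b (f p) (h^-1 *: ((g \o shift p) (h *: v) - g p))).
    apply/funext => h /=; rewrite /q bbZl bbZr bbBl bbBr -scalerDr.
    by rewrite addrA subrK.
  apply: cvgD; apply: cvg_bilin => //; last exact: cvg_cst.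
  exact: cvg_within_filter gc.
by split; [apply/cvg_ex; eexists; exact: C|exact: cvg_lim].
Qed.

End BoundedBilinear.

Section BoundedLinear.
Variables (R : realType) (E F : normedModType R).

Definition bounded_lin (l : E -> F) : Prop :=
  linear l /\ exists K : R, forall x, `|l x| <= K * `|x|.

Variables (l : E -> F) (bl : bounded_lin l).

(** Reduces the rules for linear maps to those for bilinear maps, applied to the
    constant scalar 1. *)
Lemma bounded_lin_bilinear :
  bounded_bilinear (fun (r : R) (x : E) => r *: l x).
Proof.
have [ll [K lK]] := bl; split.
- by move=> y a u v; rewrite scalerDl scalerA.
- by move=> r a u v; rewrite ll scalerDr !scalerA mulrC.
- exists K => r x; rewrite normrZ (mulrC K) -mulrA ler_wpM2l//.
Qed.

Lemma is_derive_lin (X : normedModType R) (f : X -> E) (p v : X) (df : E) :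
  is_derive p v f df -> is_derive p v (l \o f) (l df).
Proof.
move=> fd; have := is_derive_bilin bounded_lin_bilinear (is_derive_cst (1 : R) p v) fd.
rewrite scale0r add0r scale1r.
suff -> : l \o f = (fun q => cst (1 : R) q *: l (f q)) by [].
by apply/funext => q; rewrite /= scale1r.
Qed.

Lemma cvg_lin (T : Type) (S : set_system T) {FS : Filter S} (u : T -> E) x :
  u @ S --> x -> (l \o u) @ S --> l x.
Proof.
move=> ux; rewrite (_ : l \o u = (fun t => 1 *: l (u t))); last first.
  by apply/funext => t; rewrite scale1r.
rewrite -[l x]scale1r.
by apply: (cvg_bilin bounded_lin_bilinear _ ux); exact: cvg_cst.
Qed.

End BoundedLinear.

Section Smoothness.
Variables (R : realType).
Implicit Types (X E F G : normedModType R).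

Lemma derivable_is X E (f : X -> E) p v : derivable f p v ->
  is_derive p v f ('D_v f p).
Proof. exact: derivableP. Qed.

Lemma is_derive_add X E (f g : X -> E) p v df dg :
  is_derive p v f df -> is_derive p v g dg ->
  is_derive p v (fun q => f q + g q) (df + dg).
Proof. exact: is_deriveD. Qed.

Lemma is_derive_sub X E (f g : X -> E) p v df dg :
  is_derive p v f df -> is_derive p v g dg ->
  is_derive p v (fun q => f q - g q) (df - dg).
Proof. exact: is_deriveB. Qed.

Lemma Cn_eq X E n (U : set X) (f g : X -> E) : open U ->
  (forall p, U p -> f p = g p) -> Cn n U f -> Cn n U g.
Proof.
move=> oU; elim: n f g => [|n IH] f g fg [fc fd].
  split=> // p Up; rewrite /prop_for /continuous_at -fg//.
  apply: cvg_trans (fc p Up); apply: near_eq_cvg.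
  by have := open_nbhs_nbhs (conj oU Up); apply: filterS => q /fg.
have nfg p : U p -> \near p, f p = g p.
  by move=> Up; have := open_nbhs_nbhs (conj oU Up); apply: filterS => q /fg.
split=> [p Up|v].
  rewrite /prop_for /continuous_at -fg//.
  by apply: cvg_trans (fc p Up); apply: near_eq_cvg; exact: nfg.
have [dv cv] := fd v; split=> [p Up|].
  by apply: near_eq_derivable (dv p Up); exact: nfg.
by apply: IH cv => p Up; apply: near_eq_derive; exact: nfg.
Qed.

Lemma CnW X E n (U : set X) (f : X -> E) : Cn n.+1 U f -> Cn n U f.
Proof.
elim: n f => [|n IH] f [fc fd]; first by split.
by split=> // v; have [dv cv] := fd v; split=> //; exact: IH.
Qed.

(** Differentiation rules lift to the class C^n as soon as the derivatives that
    they produce are again of class C^(n-1). *)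
Lemma CnS_is X E n (U : set X) (f : X -> E) (df : X -> X -> E) : open U ->
  (forall p, U p -> {for p, continuous f}) ->
  (forall p v, U p -> is_derive p v f (df v p)) ->
  (forall v, Cn n U (df v)) -> Cn n.+1 U f.
Proof.
move=> oU fc fd dc; split=> // v; split=> [p Up|].
  exact: (@ex_derive _ _ _ _ _ _ _ (fd p v Up)).
apply: Cn_eq (dc v) => // p Up.
by rewrite (@derive_val _ _ _ _ _ _ _ (fd p v Up)).
Qed.

Lemma Cn_is_derive X E n (U : set X) (f : X -> E) p v :
  Cn n.+1 U f -> U p -> is_derive p v f ('D_v f p).
Proof. by move=> [_ /(_ v)[fd _]] Up; apply/derivable_is/fd. Qed.

Lemma Cn_derive X E n (U : set X) (f : X -> E) v : Cn n.+1 U f ->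
  Cn n U ('D_v f).
Proof. by move=> [_ /(_ v)[]]. Qed.

Lemma Cn_continuous X E n (U : set X) (f : X -> E) p :
  Cn n U f -> U p -> {for p, continuous f}.
Proof. by case: n => [|n] [fc _]; exact: fc. Qed.

Lemma Cn_cst X E n (U : set X) (c : E) : open U -> Cn n U (fun=> c).
Proof.
move=> oU; elim: n c => [|n IH] c; first by split=> // p _; exact: cvg_cst.
apply: (@CnS_is _ _ _ _ _ (fun _ _ => 0)) => // p _; first exact: cvg_cst.
Qed.

Lemma CnD X E n (U : set X) (f g : X -> E) : open U ->
  Cn n U f -> Cn n U g -> Cn n U (fun p => f p + g p).
Proof.
move=> oU; elim: n f g => [|n IH] f g cf cg.
  by split=> // p Up; apply: cvgD; [exact: (Cn_continuous cf)|exact: (Cn_continuous cg)].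
apply: (@CnS_is _ _ _ _ _ (fun v p => 'D_v f p + 'D_v g p)) => //.
- by move=> p Up; apply: cvgD; [exact: (Cn_continuous cf)|exact: (Cn_continuous cg)].
- move=> p v Up; exact: (is_deriveD (Cn_is_derive v cf Up) (Cn_is_derive v cg Up)).
- by move=> v; apply: IH; exact: Cn_derive.
Qed.

Lemma Cn_bilin X E F G (b : E -> F -> G) n (U : set X) (f : X -> E) (g : X -> F) :
  bounded_bilinear b -> open U ->
  Cn n U f -> Cn n U g -> Cn n U (fun p => b (f p) (g p)).
Proof.
move=> bb oU; elim: n f g => [|n IH] f g cf cg.
  split=> // p Up; apply: (cvg_bilin bb);
    [exact: (Cn_continuous cf)|exact: (Cn_continuous cg)].
apply: (@CnS_is _ _ _ _ _ (fun v p => b ('D_v f p) (g p) + b (f p) ('D_v g p))) => //.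
- move=> p Up; apply: (cvg_bilin bb);
    [exact: (Cn_continuous cf)|exact: (Cn_continuous cg)].
- move=> p v Up; apply: (is_derive_bilin bb);
    [exact: (Cn_is_derive v cf)|exact: (Cn_is_derive v cg)].
- move=> v; apply: CnD => //; apply: IH; do ?exact: Cn_derive; exact: CnW.
Qed.

Lemma Cn_lin X E F (l : E -> F) n (U : set X) (f : X -> E) :
  bounded_lin l -> open U -> Cn n U f -> Cn n U (fun p => l (f p)).
Proof.
move=> bl oU cf.
have C := Cn_bilin (bounded_lin_bilinear bl) oU (Cn_cst n (1 : R) oU) cf.
by apply: Cn_eq C => // p _; rewrite scale1r.
Qed.

Lemma scale_bounded_lin E (a : R) : bounded_lin (fun x : E => a *: x).
Proof.
split; first by move=> k x y; rewrite scalerDr !scalerA mulrC.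
by exists `|a| => x; rewrite normrZ.
Qed.

Lemma scale_bounded_bilinear E : bounded_bilinear (fun (a : R) (x : E) => a *: x).
Proof.
split=> [y a u v|x a u v|]; first by rewrite scalerDl scalerA.
- by rewrite scalerDr !scalerA mulrC.
- by exists 1 => x y; rewrite normrZ mul1r.
Qed.

Lemma CnZ X E n (U : set X) (a : R) (f : X -> E) : open U ->
  Cn n U f -> Cn n U (fun p => a *: f p).
Proof. exact: (Cn_lin (scale_bounded_lin E a)). Qed.

Lemma CnB X E n (U : set X) (f g : X -> E) : open U ->
  Cn n U f -> Cn n U g -> Cn n U (fun p => f p - g p).
Proof.
move=> oU cf cg; apply: Cn_eq (CnD oU cf (CnZ (-1) oU cg)) => // p _.
by rewrite scaleN1r.
Qed.

End Smoothness.

Section Schwarz.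
Variables (R : realType) (X E : normedModType R).

Lemma is_derive_line (f : X -> E) (q w : X) (k : R) (d : E) :
  is_derive (k *: w + q) w f d -> is_derive k 1 (fun s : R => f (s *: w + q)) d.
Proof.
move=> /is_deriveP H; apply/is_deriveP => e /H; apply: filterS => h.
by rewrite [_%:A]mulr1 scalerDl addrA.
Qed.

Lemma is_derive_scale (A : E) (k : R) : is_derive k 1 (fun s : R => s *: A) A.
Proof.
apply/is_deriveP => e e0; near=> h.
by rewrite [_%:A]mulr1 scalerDl addrK subrr normr0 mulr_ge0// ltW.
Unshelve. all: by end_near. Qed.

(** The mean value inequality in the direction v controls the increment of the
    derivative along w, and a second use of it in the direction w controls the
    increment of f. *)
Lemma second_difference (U : set X) (f : X -> E) (p v w : X) : open U ->
  Cn 2 U f -> U p -> forall e : R, 0 < e -> exists2 d : R, 0 < d &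
  forall h, 0 < h < d ->
  `|f (h *: w + (h *: v + p)) - f (h *: w + p) - h *: (h *: 'D_v ('D_w f) p)
    - (f (h *: v + p) - f p)| <= e * h * h.
Proof.
move=> oU cf Up e e0; set A := 'D_v ('D_w f) p.
have cg : {for p, continuous ('D_v ('D_w f))}.
  by apply: (@Cn_continuous _ _ _ 0 U) => //; do 2!apply: Cn_derive.
have /nbhs_ballP[d /= d0 dP] : \forall y \near p,
    U y /\ `|A - 'D_v ('D_w f) y| <= e.
  near=> y; split; near: y; first exact: open_nbhs_nbhs.
  by move/cvgrPdist_le : cg; exact.
have K0 : 0 < `|v| + `|w| + 1 by rewrite ltr_wpDl// addr_ge0.
exists (d / (`|v| + `|w| + 1)); first by rewrite divr_gt0.
move=> h /andP[h0]; rewrite ltr_pdivlMr// => hd.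
have near_p k u : 0 <= k <= h -> 0 <= u <= h ->
    U (u *: v + (k *: w + p)) /\
    `|A - 'D_v ('D_w f) (u *: v + (k *: w + p))| <= e.
  move=> /andP[k0 kh] /andP[u0 uh]; apply: dP; rewrite -ball_normE /=.
  have -> : p - (u *: v + (k *: w + p)) = - (u *: v + k *: w).
    by lmod_over R X.
  rewrite normrN.
  rewrite (le_lt_trans (ler_normD _ _))// !normrZ !ger0_norm//.
  apply: le_lt_trans hd; rewrite mulrDr mulr1 mulrDr.
  by rewrite -[leLHS]addr0 lerD// ?lerD ?ler_wpM2r// ltW.
have h00 : (0 : R) <= 0 <= h by rewrite lexx ltW.
have hh : 0 <= h <= h by rewrite lexx ltW.
have step k : 0 <= k <= h -> `|'D_w f (k *: w + (h *: v + p)) -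
    'D_w f (k *: w + p) - h *: A| <= e * h.
  move=> kh.
  pose phi (u : R) := 'D_w f (u *: v + (k *: w + p)) - u *: A.
  have -> : 'D_w f (k *: w + (h *: v + p)) - 'D_w f (k *: w + p) - h *: A =
      phi h - phi 0.
    by rewrite /phi !scale0r subr0 add0r (addrCA (h *: v)) addrAC.
  rewrite -[X in _ <= e * X]subr0; apply: (@mean_value_inequality R E phi
    (fun u => 'D_v ('D_w f) (u *: v + (k *: w + p)) - A)); first exact: ltW.
  - move=> x xh; apply: is_derive_sub; last exact: is_derive_scale.
    apply: (@is_derive_line ('D_w f)); apply: (@Cn_is_derive _ _ _ 0 U).
      exact: Cn_derive.
    by have [] := near_p k x kh xh.
  - by move=> x xh; rewrite distrC; have [] := near_p k x kh xh.
pose psi (k : R) := f (k *: w + (h *: v + p)) - f (k *: w + p) - k *: (h *: A).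
have -> : f (h *: w + (h *: v + p)) - f (h *: w + p) - h *: (h *: A)
    - (f (h *: v + p) - f p) = psi h - psi 0.
  by rewrite /psi !scale0r subr0 !add0r.
rewrite -[X in _ <= _ * X]subr0; apply: (@mean_value_inequality R E psi (fun k =>
  'D_w f (k *: w + (h *: v + p)) - 'D_w f (k *: w + p) - h *: A)) => //.
  exact: ltW.
move=> x xh; apply: is_derive_sub; last exact: is_derive_scale.
apply: is_derive_sub; apply: (@is_derive_line f); apply: (@Cn_is_derive _ _ _ 1 U) => //.
  by have [] := near_p x h xh hh; rewrite addrCA.
by have [] := near_p x 0 xh h00; rewrite scale0r add0r.
Unshelve. all: by end_near. Qed.

(** The second difference is symmetric in v and w, and both iterated derivatives
    are its quotient by h^2 in the limit. *)
Lemma schwarz (U : set X) (f : X -> E) (p v w : X) : open U ->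
  Cn 2 U f -> U p -> 'D_v ('D_w f) p = 'D_w ('D_v f) p.
Proof.
move=> oU cf Up; apply/eqP; rewrite -subr_eq0 -normr_le0.
apply/ler_addgt0Pl => e e0; rewrite addr0.
have e20 : 0 < e / 2 by rewrite divr_gt0.
have [d d0 dP] := second_difference v w oU cf Up e20.
have [d' d'0 d'P] := second_difference w v oU cf Up e20.
pose h := Num.min d d' / 2.
have h0 : 0 < h by rewrite divr_gt0// lt_min d0.
have hd : h < Num.min d d'.
  by rewrite /h ltr_pdivrMr// mulr_natr mulr2n ltrDl lt_min d0.
move: (hd); rewrite lt_min => /andP[hd1 hd2].
have {dP} := dP h; rewrite h0 hd1 => /(_ isT).
have {d'P} := d'P h; rewrite h0 hd2 => /(_ isT).
rewrite (addrCA (h *: v)).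
set a := f _; set b := f _; set c := f _; set q := f p.
set A := 'D_v _ p; set B := 'D_w _ p => le1 le2.
have -> : A - B = h^-1 *: (h^-1 *: ((a - b - h *: (h *: B) - (c - q)) -
    (a - c - h *: (h *: A) - (b - q)))).
  rewrite (_ : _ - _ - _ = h *: (h *: (A - B))); last by lmod_over R E.
  by rewrite !scalerK ?gt_eqF.
rewrite !normrZ normfV gtr0_norm// !ler_pdivrMl// mulrCA.
rewrite (le_trans (ler_normB _ _))// (le_trans (lerD le1 le2))//.
by rewrite le_eqVlt; apply/orP; left; apply/eqP; field.
Qed.

End Schwarz.

(** * Bounded operators and their inverses *)

Section OperatorAlgebra.
Variables (R : realType) (W : normedModType R).
Implicit Types (f g h : bop W).

Lemma bop_normM f g : `|f * g| <= `|f| * `|g|.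
Proof.
apply: opnorm_le; first by rewrite mulr_ge0.
move=> x; rewrite bopME (le_trans (bop_normP _ _))// -mulrA ler_wpM2l//.
exact: bop_normP.
Qed.

Lemma bop_scaleAl a f g : (a *: f) * g = a *: (f * g).
Proof. exact: bopE. Qed.

Lemma bop_scaleAr a f g : f * (a *: g) = a *: (f * g).
Proof. by apply: bopE => x; rewrite bopME !bopZE bopZ. Qed.

Lemma bop_mul_bb : bounded_bilinear (fun f g : bop W => f * g).
Proof.
split=> [g a u v|f a u v|]; first by rewrite mulrDl bop_scaleAl.
- by rewrite mulrDr bop_scaleAr.
- by exists 1 => f g; rewrite mul1r bop_normM.
Qed.

Lemma bop_apply_bb : bounded_bilinear (fun (f : bop W) (x : W) => f x).
Proof.
split=> [//|f a u v|]; first exact: bop_linear.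
by exists 1 => f x; rewrite mul1r bop_normP.
Qed.

Lemma bop_norm1 : `|1 : bop W| <= 1.
Proof. by apply: opnorm_le => // x; rewrite mul1r. Qed.

Lemma bop_normX f n : `|f ^+ n| <= `|f| ^+ n.
Proof.
elim: n => [|n IH]; first by rewrite !expr0 bop_norm1.
by rewrite !exprS (le_trans (bop_normM _ _))// ler_wpM2l.
Qed.

Lemma bop_scaleX a f n : (a *: f) ^+ n = a ^+ n *: f ^+ n.
Proof.
elim: n => [|n IH]; first by rewrite !expr0 scale1r.
by rewrite !exprS IH bop_scaleAl bop_scaleAr scalerA.
Qed.

Lemma CnM (X : normedModType R) n (U : set X) (f g : X -> bop W) : open U ->
  Cn n U f -> Cn n U g -> Cn n U (fun p => f p * g p).
Proof. exact: (Cn_bilin bop_mul_bb). Qed.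

Lemma is_derive_mul (X : normedModType R) (f g : X -> bop W) p v df dg :
  is_derive p v f df -> is_derive p v g dg ->
  is_derive p v (fun q => f q * g q) (df * g p + f p * dg).
Proof. exact: (is_derive_bilin bop_mul_bb). Qed.

Lemma is_derive_mull (X : normedModType R) f (g : X -> bop W) p v dg :
  is_derive p v g dg -> is_derive p v (fun q => f * g q) (f * dg).
Proof.
move=> gd; have := is_derive_mul (is_derive_cst f p v) gd.
by rewrite mul0r add0r.
Qed.

Lemma is_derive_mulr (X : normedModType R) f (g : X -> bop W) p v dg :
  is_derive p v g dg -> is_derive p v (fun q => g q * f) (dg * f).
Proof.
move=> gd; have := is_derive_mul gd (is_derive_cst f p v).
by rewrite mulr0 addr0.
Qed.

Lemma bop_mulE f g : f * g = bop_mul f g. Proof. by []. Qed.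

End OperatorAlgebra.

(** Proves identities between noncommutative polynomials in operators: products are
    distributed, and the remaining words are the atoms of [lmod_over]. The products
    are folded back to [bop_mul], so that words that are equal up to the choice of a
    canonical instance become the same atom. *)
Ltac bop_ring R W :=
  rewrite ?(mulrDl, mulrDr, mulNr, mulrN, bop_scaleAl, bop_scaleAr, mul1r, mulr1,
    mulr0, mul0r, mulrA) ?bop_mulE;
  lmod_over R (bop W).

Section Inverse.
Variables (R : realType) (W : normedModType R).
Implicit Types (f g h : bop W).

Lemma binv_unique g h : g * h = 1 -> h * g = 1 -> binv g = h.
Proof.
move=> gh hg; rewrite /binv; apply: xget_subset1 => //= a b [ga ag] [gb bg].
by rewrite -[a]mulr1 -gb mulrA ag mul1r.
Qed.

Lemma binvK g : GL g -> g * binv g = 1.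
Proof. by move=> [h [gh hg]]; rewrite (binv_unique gh hg). Qed.

Lemma binvKl g : GL g -> binv g * g = 1.
Proof. by move=> [h [gh hg]]; rewrite (binv_unique gh hg). Qed.

Lemma GL_binv g : GL g -> GL (binv g).
Proof. by move=> gG; exists g; rewrite binvK ?binvKl. Qed.

Lemma GL_mul g h : GL g -> GL h -> GL (g * h).
Proof.
move=> gG hG; exists (binv h * binv g); split.
  by rewrite mulrA -(mulrA g) binvK// mulr1 binvK.
by rewrite mulrA -(mulrA _ (binv g)) binvKl// mulr1 binvKl.
Qed.

Lemma binvM g h : GL g -> GL h -> binv (g * h) = binv h * binv g.
Proof.
move=> gG hG; apply: binv_unique.
  by rewrite mulrA -(mulrA g) binvK// mulr1 binvK.
by rewrite mulrA -(mulrA _ (binv g)) binvKl// mulr1 binvKl.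
Qed.

Lemma binv_sub g h : GL g -> GL h ->
  binv h - binv g = binv h * (g - h) * binv g.
Proof.
move=> gG hG; rewrite mulrBr mulrBl binvKl// mul1r -mulrA binvK// mulr1.
by [].
Qed.

(** The smallness hypothesis gives |h^-1| <= 2 |g^-1|, which bounds the right-hand
    side of [binv_sub]. *)
Lemma binv_lipschitz g h : GL g -> GL h -> `|g - h| * `|binv g| <= 2^-1 ->
  `|binv h - binv g| <= 2 * `|binv g| ^+ 2 * `|g - h|.
Proof.
move=> gG hG small.
have est : `|binv h - binv g| <= `|binv h| * (`|g - h| * `|binv g|).
  rewrite binv_sub// mulrA (le_trans (bop_normM _ _))// ler_wpM2r//.
  exact: bop_normM.
have bnd : `|binv h| <= 2 * `|binv g|.
  have := ler_normD (binv h - binv g) (binv g); rewrite subrK => le1.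
  have le2 : `|binv h| * (`|g - h| * `|binv g|) <= `|binv h| * 2^-1.
    by rewrite ler_wpM2l.
  lra.
rewrite (le_trans est)// expr2.
have -> : 2 * (`|binv g| * `|binv g|) * `|g - h| =
  2 * `|binv g| * (`|g - h| * `|binv g|) by ring.
by rewrite ler_wpM2r// mulr_ge0.
Qed.

Lemma cvg_binv (T : Type) (S : set_system T) {FS : Filter S} (u : T -> bop W) g :
  GL g -> (\forall t \near S, GL (u t)) -> u @ S --> g ->
  (fun t => binv (u t)) @ S --> binv g.
Proof.
move=> gG uG ug; apply/cvgrPdist_le => e e0.
pose k := `|binv g| + 1.
have k0 : 0 < k by rewrite ltr_wpDl.
have kg : `|binv g| <= k by rewrite lerDl.
near=> t; rewrite distrC.
have uGt : GL (u t) by near: t.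
have small : `|g - u t| <= 2^-1 / k.
  near: t; move/cvgrPdist_le : ug; apply.
  by rewrite divr_gt0.
rewrite (le_trans (binv_lipschitz gG uGt _))//.
  rewrite (@le_trans _ _ (`|g - u t| * k))// ?ler_wpM2l//.
  by rewrite -ler_pdivlMr.
have small' : `|g - u t| <= e / (2 * k ^+ 2).
  near: t; move/cvgrPdist_le : ug; apply.
  by rewrite divr_gt0// mulr_gt0// exprn_gt0.
rewrite (@le_trans _ _ (2 * k ^+ 2 * `|g - u t|))//.
  by rewrite ler_wpM2r// ler_wpM2l// lerXn2r// ?nnegrE// ltW.
by rewrite mulrC -ler_pdivlMr// mulr_gt0// exprn_gt0.
Unshelve. all: by end_near. Qed.

Lemma is_derive_binv (X : normedModType R) (U : set X) (c : X -> bop W) p v dc :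
  open U -> (forall q, U q -> GL (c q)) -> U p -> is_derive p v c dc ->
  is_derive p v (fun q => binv (c q)) (- (binv (c p) * dc * binv (c p))).
Proof.
move=> oU cG Up cd.
have cc := is_derive_continuous_line cd.
have Unear := near_line v oU Up.
have ic : (fun h : R => binv (c (h *: v + p))) @ (0 : R) --> binv (c p).
  by apply: cvg_binv => //; [exact: cG|apply: filterS Unear => h /cG].
have q : (fun h : R => h^-1 *: ((c \o shift p) (h *: v) - c p)) @ 0^' --> dc.
  by have [d <-] := cd; exact: d.
set i := fun q => binv (c q).
have C : (fun h : R => h^-1 *: ((i \o shift p) (h *: v) - i p)) @ 0^' -->
    - (binv (c p) * dc * binv (c p)).
  have C1 : (fun h : R => - (binv (c (h *: v + p)) *
      (h^-1 *: ((c \o shift p) (h *: v) - c p)) * binv (c p))) @ 0^' -->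
      - (binv (c p) * dc * binv (c p)).
    apply: cvgN; apply: (cvg_bilin (bop_mul_bb W)); last exact: cvg_cst.
    apply: (cvg_bilin (bop_mul_bb W)) => //; exact: cvg_within_filter ic.
  apply: cvg_trans C1; apply: near_eq_cvg.
  rewrite near_withinE; apply: filterS Unear => h Uh _ /=.
  rewrite /i binv_sub; [|exact: cG|exact: cG].
  by rewrite bop_scaleAr bop_scaleAl -scalerN -opprB mulrN mulNr opprK.
by split; [apply/cvg_ex; eexists; exact: C|exact: cvg_lim].
Qed.

Lemma Cn_binv (X : normedModType R) n (U : set X) (c : X -> bop W) : open U ->
  (forall q, U q -> GL (c q)) -> Cn n U c -> Cn n U (fun q => binv (c q)).
Proof.
move=> oU cG; have cont m p : Cn m U c -> U p ->
    {for p, continuous (fun q => binv (c q))}.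
  move=> cc Up; apply: cvg_binv; first exact: cG.
    by have := open_nbhs_nbhs (conj oU Up); apply: filterS => q /cG.
  exact: (Cn_continuous cc).
elim: n => [|n IH] cc; first by split=> // p; exact: cont cc.
apply: (@CnS_is _ _ _ _ _ _
  (fun v p => - (binv (c p) * 'D_v c p * binv (c p)))) => //.
- by move=> p; exact: cont cc.
- by move=> p v Up; exact: (is_derive_binv oU cG Up (Cn_is_derive v cc Up)).
move=> v; have ci := IH (CnW cc).
apply: (@Cn_eq _ _ _ _ _
  (fun p => (-1) *: (binv (c p) * 'D_v c p * binv (c p)))) => //.
  by move=> p _; rewrite scaleN1r.
apply: CnZ => //; apply: CnM => //; apply: CnM => //; exact: Cn_derive.
Qed.

End Inverse.

(** * The exponential of a bounded operator *)

Section Completeness.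
Variables (R : realType) (W : completeNormedModType R).

(** A Cauchy filter of operators converges pointwise, and the estimates that hold
    along the filter pass to the pointwise limit. *)
Lemma bop_complete (F : set_system (bop W)) : ProperFilter F -> cauchy F -> cvg F.
Proof.
move=> FF /cauchyP Fc.
have pt x : cvg ((fun f : bop W => f x) @ F).
  apply/cauchy_cvgP/cauchyP => e e0.
  have k0 : 0 < `|x| + 1 by rewrite ltr_wpDl.
  have [f0 Ff0] := Fc _ (divr_gt0 e0 k0).
  exists (f0 x); rewrite nbhs_simpl /=; apply: filterS Ff0 => f.
  rewrite -!ball_normE /= => ff0; rewrite -[_ - _]/((f0 - f) x).
  rewrite (le_lt_trans (bop_normP _ _))//.
  rewrite (@le_lt_trans _ _ (`|f0 - f| * (`|x| + 1)))//.
    by rewrite ler_wpM2l// lerDl.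
  by rewrite -ltr_pdivlMr.
pose l x := lim ((fun f : bop W => f x) @ F).
have lx x : (fun f : bop W => f x) @ F --> l x by exact: pt.
have near_l e f0 : F (ball f0 e) -> forall x, `|l x - f0 x| <= e * `|x|.
  move=> Ff0 x; apply/ler_addgt0Pl => d d0.
  have /cvgrPdist_le/(_ d d0) lxd := lx x.
  have [f [ld]] := filter_ex (filterI lxd Ff0).
  rewrite -ball_normE /= => /ltW fe.
  rewrite -[l x](subrK (f x)) -addrA (le_trans (ler_normD _ _))// lerD//.
  rewrite -[_ - _]/((f - f0) x) (le_trans (bop_normP _ _))//.
  by rewrite ler_wpM2r// distrC.
have ll : linear l.
  move=> a x y.
  have h2 : (fun f : bop W => f (a *: x + y)) @ F --> a *: l x + l y.
    rewrite (_ : (fun f : bop W => f (a *: x + y)) =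
      (fun f : bop W => a *: f x + f y)).
      by apply: cvgD => //; apply: cvgZl_tmp.
    by apply/funext => f; rewrite bop_linear.
  exact: (cvg_unique _ (lx _) h2).
have lb : bounded_linear l.
  split=> //; have [f0 Ff0] := Fc 1 ltr01; exists (1 + `|f0|) => x.
  rewrite -[l x](subrK (f0 x)) (le_trans (ler_normD _ _))// mulrDl.
  by rewrite lerD ?bop_normP// near_l.
apply/cvg_ex; exists (mk_bop lb); apply/fcvgrPdist_lt => e e0.
have e20 : 0 < e / 2 by rewrite divr_gt0.
have [f0 Ff0] := Fc _ e20; apply: filterS (Ff0) => f.
rewrite -ball_normE /= => ff0.
have -> : mk_bop lb - f = (mk_bop lb - f0) + (f0 - f) by rewrite addrA subrK.
rewrite (le_lt_trans (ler_normD _ _))// [e]splitr ler_ltD//.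
by apply: opnorm_le => [|x]; [exact: ltW|rewrite bopDE bopNE near_l].
Qed.

HB.instance Definition _ := Uniform_isComplete.Build (bop W) bop_complete.

End Completeness.

Section NormLimit.
Variables (R : realType) (E : normedModType R).

Lemma lim_norm_le (u : nat -> E) (l : E) (c : R) :
  u @ \oo --> l -> (forall n, `|u n| <= c) -> `|l| <= c.
Proof.
move=> ul uc; apply/ler_addgt0Pl => e e0.
have /cvgrPdist_le/(_ e e0)/filter_ex[n le] := ul.
rewrite -[l](subrK (u n)) (le_trans (ler_normD _ _))// lerD//.
Qed.

End NormLimit.

Section Exponential.
Variables (R : realType) (W : completeNormedModType R).
Implicit Types (f g A B : bop W).

Let term f (n : nat) : bop W := (n`!%:R : R)^-1 *: f ^+ n.

Let fact_ge0 n : (0 : R) <= (n`!%:R)^-1.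
Proof. by rewrite invr_ge0. Qed.

Let term_norm f n : `|term f n| <= exp_coeff `|f| n.
Proof.
by rewrite normrZ ger0_norm// mulrC ler_wpM2r// bop_normX.
Qed.

Lemma bexp_cvg f : series (term f) @ \oo --> bexp f.
Proof.
have : cvgn (series (term f)).
  apply: normed_cvg.
  apply: (@series_le_cvg _ (fun n => `|term f n|) (exp_coeff `|f|)) => //.
  - by move=> n; rewrite exp_coeff_ge0.
  - exact: is_cvg_series_exp_coeff.
exact.
Qed.

Lemma bexp0 : bexp (0 : bop W) = 1.
Proof.
apply: cvg_lim => //; rewrite -cvg_shiftS /=.
rewrite (_ : (fun n => _) = cst 1); first exact: cvg_cst.
apply/funext => n; rewrite /series /= big_nat_recl// expr0 fact0 invr1 scale1r.
by rewrite big1 ?addr0// => i _; rewrite exprS mul0r scaler0.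
Qed.

Lemma bexp_comm A B : A * B = B * A -> bexp A * B = B * bexp A.
Proof.
move=> AB.
have L : (fun n => series (term A) n * B) @ \oo --> bexp A * B.
  by apply: (cvg_bilin (bop_mul_bb W)); [exact: bexp_cvg|exact: cvg_cst].
have L' : (fun n => B * series (term A) n) @ \oo --> B * bexp A.
  by apply: (cvg_bilin (bop_mul_bb W)); [exact: cvg_cst|exact: bexp_cvg].
rewrite (_ : (fun n => series (term A) n * B) =
  (fun n => B * series (term A) n)) in L; first exact: (cvg_unique _ L L').
apply/funext => n; rewrite /series /= mulr_suml mulr_sumr; apply: eq_bigr => i _.
rewrite bop_scaleAl bop_scaleAr; congr (_ *: _).
elim: (i : nat) => [|k IH]; first by rewrite !expr0 mulr1 mul1r.
by rewrite exprS -mulrA IH mulrA AB -mulrA.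
Qed.

(** The second-order remainder of t^n. *)
Let dif (t h : R) n : R := (t + h) ^+ n - t ^+ n - n%:R * h * t ^+ n.-1.

Let dif_bound (t h : R) n :
  `|dif t h n.+2| <= h ^+ 2 * (n.+2 * n.+1)%:R * (`|t| + `|h|) ^+ n.
Proof.
have rec m : dif t h m.+2 = (t + h) * dif t h m.+1 + m.+1%:R * h ^+ 2 * t ^+ m.
  rewrite /dif /= !exprS -[m.+2%:R]natr1; set a := (t + h) ^+ m.
  by set b := t ^+ m; ring.
elim: n => [|n IH].
  have -> : dif t h 2 = h ^+ 2 by rewrite /dif; ring.
  rewrite expr0 mulr1 muln1 ger0_norm ?sqr_ge0// ler_peMr ?sqr_ge0//.
  by rewrite ler1n.
rewrite rec; set r := `|t| + `|h|.
have r0 : 0 <= r by rewrite addr_ge0.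
rewrite (le_trans (ler_normD _ _))// !normrM.
rewrite (@le_trans _ _ (r * (h ^+ 2 * (n.+2 * n.+1)%:R * r ^+ n) +
   n.+2%:R * h ^+ 2 * r ^+ n.+1))//.
  apply: lerD; first by rewrite ler_pM// ler_normD.
  rewrite normr_nat !normrX -expr2 real_normK ?num_real// ler_wpM2l//.
    by rewrite mulr_ge0// sqr_ge0.
  by rewrite lerXn2r ?nnegrE// lerDl.
rewrite [leLHS](_ : _ = h ^+ 2 * (n.+2 * n.+2)%:R * r ^+ n.+1); last first.
  by rewrite (exprS r n) !natrM -(@natr1 R n.+1); set b := r ^+ n; ring.
by rewrite ler_wpM2r ?exprn_ge0// ler_wpM2l ?sqr_ge0// ler_nat leq_mul2r leqnSn orbT.
Qed.

(** Term by term, the increment of the series minus its formal differential is the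
    remainder [dif], which [dif_bound] compares with the exponential series. *)
Let bexp_increment A (t h : R) :
  `|bexp ((t + h) *: A) - bexp (t *: A) - h *: (A * bexp (t *: A))|
  <= h ^+ 2 * (`|A| ^+ 2 * expR ((`|t| + `|h|) * `|A|)).
Proof.
pose S s N : bop W := series (term (s *: A)) N.
have SE s N : S s N = \sum_(0 <= n < N) (s ^+ n / n`!%:R) *: A ^+ n.
  by apply: eq_bigr => i _; rewrite /term bop_scaleX scalerA mulrC.
have cS s k : (fun N => S s (N + k)%N) @ \oo --> bexp (s *: A).
  by rewrite (cvg_shiftn k (S s)); exact: bexp_cvg.
have L : (fun N => S (t + h) (N + 2)%N - S t (N + 2)%N - h *: (A * S t (N + 1)%N))
    @ \oo --> bexp ((t + h) *: A) - bexp (t *: A) - h *: (A * bexp (t *: A)).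
  apply: cvgB; first by apply: cvgB; exact: cS.
  apply: cvgZl_tmp; apply: (cvg_bilin (bop_mul_bb W)); first exact: cvg_cst.
  exact: cS.
apply: (lim_norm_le L) => N.
have -> : S (t + h) (N + 2)%N - S t (N + 2)%N - h *: (A * S t (N + 1)%N) =
    \sum_(0 <= n < N) (dif t h n.+2 / n.+2`!%:R) *: A ^+ n.+2.
  rewrite !SE addn2 addn1 -sumrB mulr_sumr scaler_sumr.
  rewrite big_nat_recl// big_nat_recl// big_nat_recl//=.
  have -> : \sum_(0 <= i < N) (dif t h i.+2 / i.+2`!%:R) *: A ^+ i.+2 =
    \sum_(0 <= i < N) (((t + h) ^+ i.+2 / i.+2`!%:R) *: A ^+ i.+2 -
      (t ^+ i.+2 / i.+2`!%:R) *: A ^+ i.+2) -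
    \sum_(0 <= i < N) h *: (A * ((t ^+ i.+1 / i.+1`!%:R) *: A ^+ i.+1)).
    rewrite -sumrB; apply: eq_bigr => i _.
    rewrite bop_scaleAr -exprS scalerA -!scalerBl; congr (_ *: _).
    rewrite /dif /= [i.+2`!]factS natrM.
    have f1 : (i.+1`!%:R : R) != 0 by rewrite pnatr_eq0 -lt0n fact_gt0.
    have f2 : (i.+2%:R : R) != 0 by rewrite pnatr_eq0.
    move: f1 f2; move: (i.+2%:R : R) (i.+1`!%:R : R) ((t + h) ^+ _) (t ^+ i.+2)
      (t ^+ i.+1) => k l a b c l0 k0.
    by rewrite -[(a - b) *: _]/((a - b) * _); field; rewrite l0 k0.
  rewrite !expr0 !expr1 fact0 (_ : 1`! = 1%N)// !divr1 !scale1r mulr1.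
  set X := \sum_(0 <= i < N) _; set Y := \sum_(0 <= i < N) _.
  by lmod_over R (bop W).
rewrite (le_trans (ler_norm_sum _ _ _))//.
have e0 : 0 <= h ^+ 2 * `|A| ^+ 2 by rewrite mulr_ge0 ?sqr_ge0.
rewrite (@le_trans _ _ (h ^+ 2 * `|A| ^+ 2 *
    series (exp_coeff ((`|t| + `|h|) * `|A|)) N))//; last first.
  rewrite [leRHS]mulrA ler_wpM2l// /expR.
  apply: nondecreasing_cvgn_le; last exact: is_cvg_series_exp_coeff.
  apply: nondecreasing_series => n _ _; rewrite exp_coeff_ge0//.
rewrite /series /= mulr_sumr ler_sum// => n _.
rewrite normrZ (le_trans (ler_wpM2l _ (bop_normX _ _)))//.
rewrite normrM normfV normr_nat.
rewrite (@le_trans _ _ (h ^+ 2 * (n.+2 * n.+1)%:R * (`|t| + `|h|) ^+ n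
   / n.+2`!%:R * `|A| ^+ n.+2))//.
  by rewrite ler_wpM2r ?exprn_ge0// ler_wpM2r// dif_bound.
have -> : `|A| ^+ n.+2 = `|A| ^+ n * `|A| ^+ 2 by rewrite -exprD addn2.
rewrite /exp_coeff /= !factS !natrM exprMn.
have f1 : (n`!%:R : R) != 0 by rewrite pnatr_eq0 -lt0n fact_gt0.
have f2 : (n.+2%:R : R) != 0 by rewrite pnatr_eq0.
have f3 : (n.+1%:R : R) != 0 by rewrite pnatr_eq0.
rewrite le_eqVlt; apply/orP; left; apply/eqP.
move: f1 f2 f3; move: (n`!%:R : R) (n.+2%:R : R) (n.+1%:R : R) (`|A| ^+ n)
  ((_ + _) ^+ n) => k l m a b k0 l0 m0.
by field; rewrite k0 l0 m0.
Qed.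

Lemma bexp_derive A (t : R) :
  is_derive t 1 (fun s : R => bexp (s *: A)) (A * bexp (t *: A)).
Proof.
apply/is_deriveP => e e0.
set C := `|A| ^+ 2 * expR ((`|t| + 1) * `|A|).
have C0 : 0 <= C by rewrite mulr_ge0 ?exprn_ge0// expR_ge0.
have C1 : 0 < C + 1 by rewrite ltr_wpDl.
have := @nbhs0_lt R R _ (divr_gt0 e0 C1); have := @nbhs0_lt R R 1 ltr01.
apply: filterS2 => h /ltW h1 /ltW he.
rewrite [_%:A]mulr1 (addrC h) (le_trans (bexp_increment _ _ _))//.
rewrite (@le_trans _ _ (h ^+ 2 * C))//.
  rewrite ler_wpM2l ?sqr_ge0// ler_wpM2l ?exprn_ge0// ler_expR.
  by rewrite ler_wpM2r// lerD2l.
rewrite -[h ^+ 2]real_normK ?num_real// expr2 -mulrA mulrC ler_wpM2r//.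
rewrite (@le_trans _ _ (`|h| * (C + 1)))// ?ler_wpM2l ?lerDl//.
by rewrite -ler_pdivlMr.
Qed.

Lemma bexp_scale_comm A (t : R) : bexp (t *: A) * A = A * bexp (t *: A).
Proof. by apply: bexp_comm; rewrite bop_scaleAl bop_scaleAr. Qed.

Lemma bexp_derive_dir A (t v : R) :
  is_derive t v (fun s : R => bexp (s *: A)) (v *: (A * bexp (t *: A))).
Proof.
have [d1 dv] := bexp_derive A t; have d := (derivable1_diffP _ _).1 d1.
split; first exact: diff_derivable.
rewrite deriveE// -{1}[v]mulr1 -[v * 1]/(v *: 1) linearZ /= -deriveE//.
by rewrite dv.
Qed.

Lemma bexp_scaleN_derive A (t : R) :
  is_derive t 1 (fun s : R => bexp (- s *: A)) (- (A * bexp (- t *: A))).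
Proof.
have := bexp_derive (- A) t; rewrite mulNr !scalerN -scaleNr.
rewrite (_ : (fun s : R => bexp (s *: - A)) = (fun s : R => bexp (- s *: A)))//.
by apply/funext => s; rewrite scalerN scaleNr.
Qed.

Lemma bexpN A (t : R) : bexp (t *: A) * bexp (- t *: A) = 1.
Proof.
pose f (s : R) := bexp (s *: A) * bexp (- s *: A).
have fd s : [set: R] s -> is_derive s 1 f 0.
  move=> _; apply: is_derive_eq.
    exact: is_derive_mul (bexp_derive A s) (bexp_scaleN_derive A s).
  by rewrite mulrN mulrA bexp_scale_comm subrr.
rewrite -[LHS]/(f t) (@derive0_constant _ _ setT f _ fd t 0)//.
by rewrite /f oppr0 !scale0r bexp0 mulr1.
Qed.

Lemma bexpNl A (t : R) : bexp (- t *: A) * bexp (t *: A) = 1.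
Proof. by rewrite -{2}[t]opprK bexpN. Qed.

Lemma GL_bexp A (t : R) : GL (bexp (t *: A)).
Proof. by exists (bexp (- t *: A)); rewrite bexpN bexpNl. Qed.

Lemma Cn_bexp n A : Cn n [set: R] (fun s : R => bexp (s *: A)).
Proof.
have cont (t : R) : {for t, continuous (fun s : R => bexp (s *: A))}.
  have [d1 _] := bexp_derive A t.
  by apply: differentiable_continuous; apply/derivable1_diffP.
elim: n => [|n IH]; first by split.
apply: (@CnS_is _ _ _ _ _ _ (fun v t : R => v *: (A * bexp (t *: A)))).
- exact: openT.
- by move=> t _; exact: cont.
- by move=> t v _; exact: bexp_derive_dir.
move=> v; apply: CnZ; first exact: openT.
by apply: CnM => //; [exact: openT|apply: Cn_cst; exact: openT].
Qed.

End Exponential.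

(** * Identities in Jordan algebras *)

Section JordanIdentities.
Variables (R : realType) (V : jbAlgType R).
Implicit Types (x y z a : V) (D H : bop V).

Let jordan_comm x : Lop (x *j x) * Lop x = Lop x * Lop (x *j x).
Proof. by apply: bopE => y; rewrite !bopME !LopE jordan_id. Qed.

(** The part of the Jordan identity at z + a that is linear in a. The one at z - a
    differs from it in the sign of that part. *)
Let jordan_polar z a : Lop (z *j z) * Lop a - Lop a * Lop (z *j z)
  + 2 *: (Lop (a *j z) * Lop z - Lop z * Lop (a *j z)) = 0.
Proof.
have := jordan_comm (z + a); have := jordan_comm (z - a).
rewrite !(jmulDl, jmulDr, jmulNl, jmulNr, LopD, LopN) (jmulC z a) => e1 e2.
move/eqP: e1; rewrite -subr_eq0 => /eqP e1.
move/eqP: e2; rewrite -subr_eq0 => /eqP e2.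
transitivity (2^-1 *: (0 - 0 : bop V)); last by rewrite subr0 scaler0.
rewrite -[in X in _ = _ *: (X - _)]e2 -e1.
have := jordan_comm z; have := jordan_comm a.
set la := Lop a; set lz := Lop z; set laa := Lop (a *j a).
set lzz := Lop (z *j z); set laz := Lop (a *j z) => ca cz.
rewrite !(mulrDl, mulrDr, mulNr, mulrN) ca cz.
by bop_ring R V.
Qed.

Let jordan_lin3 z a c :
  Lop (a *j z) * Lop c - Lop c * Lop (a *j z)
  + (Lop (z *j c) * Lop a - Lop a * Lop (z *j c))
  + (Lop (a *j c) * Lop z - Lop z * Lop (a *j c)) = 0.
Proof.
have := jordan_polar (z + c) a; have := jordan_polar z a; have := jordan_polar c a.
rewrite !(jmulDl, jmulDr, LopD) (jmulC c z) => e1 e2 e3.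
transitivity (2^-1 *: (0 - 0 - 0 : bop V)); last by rewrite !subr0 scaler0.
by rewrite -[in X in _ *: (X - _ - _)]e3 -[in X in _ *: (_ - X - _)]e2 -e1; bop_ring R V.
Qed.

(** [jordan_lin3] applied to z and read as an identity of operators acting on c. *)
Let jordan_operator z a :
  2 *: (Lop (a *j z) * Lop z) + Lop (z *j z) * Lop a =
  Lop (z *j (a *j z)) + Lop a * Lop z * Lop z + Lop z * Lop z * Lop a.
Proof.
apply: bopE => c; have /(congr1 (fun f : bop V => f z)) := jordan_lin3 z a c.
rewrite !(bopDE, bopNE, bopZE, bopME, LopE, bop0E) => e.
rewrite (jmulC c z) (jmulC c (a *j z *j z)) (jmulC (a *j z) z) in e.
rewrite (jmulC (z *j c) (a *j z)) (jmulC (z *j c) z) in e.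
rewrite (jmulC (a *j c) (z *j z)) (jmulC (a *j c) z) in e.
by rewrite -[RHS]addr0 -e; lmod_over R V.
Qed.

(** The polarization of [Uop]. *)
Definition Uop2 z w : bop V := Lop z * Lop w + Lop w * Lop z - Lop (z *j w).

Lemma Uop2_Lop z a : 2 *: Uop2 z (a *j z) = Lop a * Uop z + Uop z * Lop a.
Proof.
have := jordan_operator z a; have := jordan_polar z a; rewrite /Uop2 /Uop.
set la := Lop a; set lz := Lop z; set lzz := Lop (z *j z).
set laz := Lop (a *j z); set lzaz := Lop (z *j _) => e1 e2.
have -> : lzaz = 2 *: (laz * lz) + lzz * la - la * lz * lz - lz * lz * la.
  by rewrite e2; lmod_over R (bop V).
by rewrite -[RHS]subr0 -e1; bop_ring R V.
Qed.

Lemma Der_Lop D x : Der D -> D * Lop x = Lop (D x) + Lop x * D.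
Proof.
move=> hD; have := bracketLD x hD; rewrite /bracket => e.
by rewrite -[Lop (D x)]opprK -e; bop_ring R V.
Qed.

Lemma Uop2_Der z D : Der D -> 2 *: Uop2 z (D z) = D * Uop z - Uop z * D.
Proof.
move=> hD; rewrite /Uop2 /Uop mulrBr bop_scaleAr mulrA !(Der_Lop _ hD) mulrDl.
rewrite -(mulrA _ D) (Der_Lop _ hD) hD (jmulC (D z)) LopD.
by bop_ring R V.
Qed.

(** str(V) consists of infinitesimal structure transformations. *)
Lemma Uop2_str z H : str_set H -> 2 *: Uop2 z (H z) = H * Uop z + Uop z * dagger H.
Proof.
move=> [x [D [hD ->]]]; rewrite daggerE// bopDE LopE.
have -> : Uop2 z (x *j z + D z) = Uop2 z (x *j z) + Uop2 z (D z).
  by rewrite /Uop2 jmulDr !LopD; bop_ring R V.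
rewrite scalerDr Uop2_Lop Uop2_Der//; bop_ring R V.
Qed.

Lemma Uop1 x : Uop x jone = x *j x.
Proof.
rewrite /Uop bopDE bopNE bopZE bopME !Lop1 LopE.
by rewrite scaler_nat mulr2n addrK.
Qed.

Lemma Uop_one : Uop (jone : V) = 1.
Proof.
rewrite /Uop jmul1; have -> : Lop (jone : V) = 1.
  by apply: bopE => x; rewrite LopE jmul1.
by rewrite mulr1 scaler_nat mulr2n addrK.
Qed.

Lemma Der_square D : (forall x, D (x *j x) = 2 *: (x *j D x)) -> Der D.
Proof.
move=> sq x y; have := sq (x + y).
rewrite !(jmulDl, jmulDr, bopD) !sq (jmulC y x) (jmulC y (D x)) => e.
have : 2^-1 *: (2 *: (x *j D x) + D (x *j y) + (D (x *j y) + 2 *: (y *j D y)) -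
   2 *: (x *j D x) - 2 *: (y *j D y)) = D (x *j y) by lmod_over R V.
by rewrite e => <-; lmod_over R V.
Qed.

(** With H = L_a + D and a = H 1, the condition says D (x^2) = 2 x o D x, because
    U_x a = 2 x o (x o a) - x^2 o a; polarizing it makes D a derivation. *)
Lemma str_square H :
  (forall x, 2 *: (x *j H x) = H (x *j x) + Uop x (H jone)) -> str_set H.
Proof.
move=> sq; exists (H jone), (H - Lop (H jone)); split; last first.
  by rewrite addrC subrK.
apply: Der_square => x; have := sq x.
rewrite /Uop !(bopDE, bopNE, bopZE, bopME, LopE) jmulDr jmulNr => e.
rewrite (jmulC (H jone) x) (jmulC (H jone)).
rewrite scalerBr e; lmod_over R V.
Qed.

Lemma Dpart_Der H : str_set H -> Der (Dpart H).
Proof. by move=> [x [D [hD ->]]]; rewrite DpartE. Qed.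

Lemma Lpart_Dpart H : H = Lpart H + Dpart H.
Proof. by rewrite /Dpart addrC subrK. Qed.

Lemma str_setP H : str_set H <-> Der (Dpart H).
Proof.
split=> [/Dpart_Der//|hD]; rewrite [H]Lpart_Dpart.
by exists (H jone), (Dpart H).
Qed.

Lemma strD H H' : str_set H -> str_set H' -> str_set (H + H').
Proof. move=> hA hB; exact: (strP (mk_str hA + mk_str hB)). Qed.

Lemma strZ k H : str_set H -> str_set (k *: H).
Proof. move=> hA; exact: (strP (k *: mk_str hA)). Qed.

Lemma strB H H' : str_set H -> str_set H' -> str_set (H - H').
Proof. by move=> hH hH'; rewrite -scaleN1r; apply: strD => //; exact: strZ. Qed.

End JordanIdentities.

(** * The structure group and its Lie algebra *)

Section BoundedStructureMaps.
Variables (R : realType) (V : jbAlgType R).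
Implicit Types (x y : V) (g A B D H : bop V).

Lemma bounded_lin_Lop : bounded_lin (@Lop R V).
Proof.
split=> [a x y|]; first by rewrite LopD LopZ.
exists 1 => x; rewrite mul1r; apply: opnorm_le => // y; exact: jmul_norm.
Qed.

Lemma bounded_lin_Lpart : bounded_lin (@Lpart R V).
Proof.
split; first exact: LpartZD.
by exists `|jone : V| => A; rewrite mulrC Lpart_norm.
Qed.

Lemma daggerZD a A B : dagger (a *: A + B) = a *: dagger A + dagger B.
Proof. by rewrite /dagger /Dpart LpartZD; lmod_over R (bop V). Qed.

Lemma bounded_lin_Dpart : bounded_lin (@Dpart R V).
Proof.
split; first by move=> a A B; rewrite /Dpart LpartZD; lmod_over R (bop V).
exists (1 + `|jone : V|) => A; rewrite (le_trans (ler_normB _ _))//.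
by rewrite mulrDl mul1r lerD// mulrC Lpart_norm.
Qed.

Lemma bounded_lin_dagger : bounded_lin (@dagger R V).
Proof.
split; first exact: daggerZD.
have [_ [K hK]] := bounded_lin_Dpart.
exists (`|jone : V| + K) => A; rewrite (le_trans (ler_normB _ _))//.
by rewrite mulrDl lerD// mulrC Lpart_norm.
Qed.

Lemma daggerD A B : dagger (A + B) = dagger A + dagger B.
Proof. by have := daggerZD 1 A B; rewrite !scale1r. Qed.

Lemma str_dagger H : str_set H -> str_set (dagger H).
Proof.
by move=> hH; apply: strB; [exact: str_Lpart|exact: str_Dpart].
Qed.

Lemma jmul_bb : bounded_bilinear (@jmul R V).
Proof.
split=> [y a u v|x|]; [by rewrite jmulDl jmulZl|exact: jmul_linear|].
by exists 1 => x y; rewrite mul1r jmul_norm.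
Qed.

(** By [str_setP] membership in str(V) is the Leibniz rule for the continuous
    projection [Dpart], which passes to pointwise limits. *)
Lemma str_set_closed (T : Type) (S : set_system T) {FS : ProperFilter S}
    (u : T -> bop V) (H : bop V) :
  u @ S --> H -> (\forall t \near S, str_set (u t)) -> str_set H.
Proof.
move=> uH us; apply/str_setP => x y.
have dH : (@Dpart R V \o u) @ S --> Dpart H.
  by apply: (cvg_lin bounded_lin_Dpart).
have ev z : (fun t => Dpart (u t) z) @ S --> Dpart H z.
  by apply: (cvg_bilin (bop_apply_bb V)); [exact: dH|exact: cvg_cst].
have l1 := ev (x *j y).
have l2 : (fun t => Dpart (u t) x *j y + x *j Dpart (u t) y) @ S -->
    Dpart H x *j y + x *j Dpart H y.
  apply: cvgD; apply: (cvg_bilin jmul_bb); do ?exact: ev; exact: cvg_cst.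
have l3 : (fun t => Dpart (u t) (x *j y)) @ S --> Dpart H x *j y + x *j Dpart H y.
  apply: cvg_trans l2; apply: near_eq_cvg.
  by apply: filterS us => t /Dpart_Der h; rewrite h.
exact: (cvg_unique _ l1 l3).
Qed.

(** str(V) is a closed subspace of B(V). *)
Lemma str_complete (F : set_system (str V)) : ProperFilter F -> cauchy F -> cvg F.
Proof.
move=> FF /cauchyP Fc.
have : cvg ((fun H : str V => str_val H) @ F).
  apply/cauchy_cvgP/cauchyP => e /Fc[H FH]; exists (str_val H).
  rewrite nbhs_simpl /=; apply: filterS FH => H'.
  by rewrite -!ball_normE.
move=> /cvg_ex[/= l Fl].
have hl : str_set l.
  apply: str_set_closed Fl _; near=> H; exact: strP.
apply/cvg_ex; exists (mk_str hl); apply/fcvgrPdist_lt => e e0.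
by move/cvgrPdist_lt : Fl => /(_ e e0).
Unshelve. all: by end_near. Qed.

HB.instance Definition _ := Uniform_isComplete.Build (str V) str_complete.

Lemma str_val_bounded_lin : bounded_lin (fun H : str V => str_val H).
Proof. by split=> //; exists 1 => H; rewrite mul1r. Qed.

Lemma is_derive_str_val (X : normedModType R) (f : X -> str V) p v (d : str V) :
  is_derive p v (fun q => str_val (f q)) (str_val d) <-> is_derive p v f d.
Proof.
split=> [/is_deriveP h|]; last exact: (is_derive_lin str_val_bounded_lin).
by apply/is_deriveP => e /h.
Qed.

(** Difference quotients stay in the closed subspace str(V). *)
Lemma is_derive_str (X : normedModType R) (U : set X) (f : X -> bop V) p v d :
  open U -> U p -> (forall q, U q -> str_set (f q)) -> is_derive p v f d ->
  str_set d.
Proof.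
move=> oU Up fs fd.
have L : (fun h : R => h^-1 *: ((f \o shift p) (h *: v) - f p)) @ 0^' --> d.
  by have [e <-] := fd; exact: e.
apply: str_set_closed L _; rewrite near_withinE.
apply: filterS (near_line v oU Up) => h Uh _.
by apply: strZ; apply: strB; exact: fs.
Qed.

End BoundedStructureMaps.

Section StructureGroup.
Variables (R : realType) (V : jbAlgType R).
Implicit Types (x y : V) (g h A B D H : bop V).

Lemma Str_GL g : Str V g -> GL g. Proof. by case. Qed.

Lemma Str_mul g h : Str V g -> Str V h -> Str V (g * h).
Proof.
move=> [gG [g' [g'G gU]]] [hG [h' [h'G hU]]]; split; first exact: GL_mul.
exists (h' * g'); split; first exact: GL_mul.
by move=> x; rewrite bopME gU hU !mulrA.
Qed.

Lemma Str_binv g : Str V g -> Str V (binv g).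
Proof.
move=> [gG [g' [g'G gU]]]; split; first exact: GL_binv.
exists (binv g'); split; first exact: GL_binv.
move=> x; have := gU (binv g x); rewrite -bopME binvK// bop1E => ->.
by rewrite !mulrA binvKl// mul1r -mulrA binvK// mulr1.
Qed.

Lemma is_derive_Uop (f : R -> V) (t : R) (df : V) :
  is_derive t 1 f df -> is_derive t 1 (fun s => Uop (f s)) (2 *: Uop2 (f t) df).
Proof.
move=> fd; have Ld := is_derive_lin (bounded_lin_Lop V) fd.
have sq := is_derive_bilin (jmul_bb V) fd fd.
have LLd := is_derive_mul Ld Ld.
have h1 := is_derive_lin (scale_bounded_lin (bop V) 2) LLd.
have h2 := is_derive_lin (bounded_lin_Lop V) sq.
apply: (is_derive_eq (is_derive_sub h1 h2)).
rewrite /Uop2 /= (jmulC df) LopD.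
by bop_ring R V.
Qed.

(** By [Uop2_str], e^(-sH) U_(e^(sH) x) e^(-sK), with K the dagger of H, is
    constant in s. *)
Lemma Str_bexp H (t : R) : str_set H -> Str V (bexp (t *: H)).
Proof.
move=> hH; split; first exact: GL_bexp.
exists (bexp (t *: dagger H)); split; first exact: GL_bexp.
move=> x.
pose z (s : R) := bexp (s *: H) x.
pose F (s : R) := bexp (- s *: H) * Uop (z s) * bexp (- s *: dagger H).
have zd (s : R) : is_derive s 1 z (H (z s)).
  have := is_derive_bilin (bop_apply_bb V) (bexp_derive H s) (is_derive_cst x s 1).
  by rewrite /cst bop0 addr0.
have Fd (s : R) : setT s -> is_derive s 1 F 0.
  move=> _; apply: is_derive_eq.
    apply: is_derive_mul (bexp_scaleN_derive (dagger H) s).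
    exact: is_derive_mul (bexp_scaleN_derive H s) (is_derive_Uop (zd s)).
  cbv beta; rewrite (Uop2_str _ hH) -(bexp_scale_comm H (- s)).
  set E := bexp (- s *: H); set E' := bexp _; set U := Uop _; clearbody E E' U.
  by bop_ring R V.
have : F t = F 0 by exact: (@derive0_constant _ _ setT).
rewrite /F /z oppr0 !scale0r !bexp0 mul1r mulr1 bop1E => e.
rewrite -e !mulrA bexpN mul1r -mulrA bexpNl mulr1.
by [].
Qed.

(** Differentiating (h x)^2 = h U_x h^-1 (h 1)^2 along a path h in Str(V) that
    passes through 1. *)
Lemma Str_velocity (J : set R) (c : R -> bop V) (t : R) (d : bop V) :
  open J -> J t -> (forall s, J s -> Str V (c s)) -> is_derive t 1 c d ->
  str_set (binv (c t) * d).
Proof.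
move=> oJ Jt cS cd; have tG := Str_GL (cS t Jt).
pose h s := binv (c t) * c s.
have hS s : J s -> Str V (h s).
  by move=> Js; apply: Str_mul; [apply: Str_binv|]; exact: cS.
have ht : h t = 1 by rewrite /h binvKl.
set X := binv (c t) * d.
have hd : is_derive t 1 h X by exact: is_derive_mull.
apply: str_square => x.
have ev y : is_derive t 1 (fun s => h s y) (X y).
  have := is_derive_bilin (bop_apply_bb V) hd (is_derive_cst y t 1).
  by rewrite /cst bop0 addr0.
have sq y := is_derive_bilin (jmul_bb V) (ev y) (ev y).
have id := is_derive_binv oJ (fun s Js => Str_GL (hS s Js)) Jt hd.
have r1 := is_derive_bilin (bop_apply_bb V) id (sq jone).
have r2 := is_derive_bilin (bop_apply_bb V) (is_derive_cst (Uop x) t 1) r1.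
have r3 := is_derive_bilin (bop_apply_bb V) hd r2.
have eqn s : J s -> h s (Uop x (binv (h s) (h s jone *j h s jone))) =
    h s x *j h s x.
  move=> Js; have [hG [h' [h'G hU]]] := hS s Js.
  rewrite -!Uop1 !hU Uop_one mulr1 -!bopME.
  by rewrite mulrA -(mulrA (h s * Uop x)) (binvKl hG) mulr1.
have near_eqn : \near t, h t (Uop x (binv (h t) (h t jone *j h t jone))) =
    h t x *j h t x.
  by have := open_nbhs_nbhs (conj oJ Jt); apply: filterS => s /eqn.
have r4 := near_eq_is_derive near_eqn r3.
have := @derive_val _ _ _ _ _ _ _ r4; rewrite (@derive_val _ _ _ _ _ _ _ (sq x)).
rewrite /cst; cbv beta; rewrite ht (binv_unique (mulr1 1) (mulr1 1)).
clearbody X h; have := Uop1 x; move: (Uop x) => U U1.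
rewrite !(mul1r, mulr1, bop1E, bopNE, bop0E, bopD, bopN, add0r) jmul1 U1.
rewrite (jmulC _ jone) jmul1 (jmulC _ x) => e.
rewrite scaler_nat mulr2n e.
by lmod_over R V.
Qed.

End StructureGroup.

(** * The covariant derivative *)

Section Smooth.
Variables (R : realType).
Implicit Types (E F : normedModType R).

Lemma derive1_fun E (f : R -> E) : derive1 f = 'D_1 f.
Proof. by apply/funext => t; rewrite derive1E. Qed.

Lemma Cn_derive1 E n (J : set R) (f : R -> E) : Cn n.+1 J f -> Cn n J (derive1 f).
Proof. by rewrite derive1_fun; exact: Cn_derive. Qed.

Lemma smooth_is_derive E (J : set R) (f : R -> E) (t : R) : smooth_on J f ->
  J t -> is_derive t 1 f (derive1 f t).
Proof. by rewrite derive1E => sf; exact: (Cn_is_derive (1 : R) (sf 1%N)). Qed.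

Lemma is_derive_derive1 E (f : R -> E) (t : R) d : is_derive t 1 f d -> derive1 f t = d.
Proof. by move=> fd; rewrite derive1E (@derive_val _ _ _ _ _ _ _ fd). Qed.

Lemma derive1_slice1 E (f : R * R -> E) (s t : R) :
  derive1 (fun s' => f (s', t)) s = 'D_(1, 0) f (s, t).
Proof.
rewrite /derive1 /derive; set d := (fun _ : R => _); set d' := (fun _ : R => _).
suff -> : d = d' by []; apply/funext => h; rewrite /d /d' /=.
by rewrite [h *: (1, 0)](_ : _ = (h * 1, h * 0))// mulr1 mulr0
  [(h, 0) + (s, t)](_ : _ = (h + s, 0 + t))// add0r.
Qed.

Lemma derive1_slice2 E (f : R * R -> E) (s t : R) :
  derive1 (fun t' => f (s, t')) t = 'D_(0, 1) f (s, t).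
Proof.
rewrite /derive1 /derive; set d := (fun _ : R => _); set d' := (fun _ : R => _).
suff -> : d = d' by []; apply/funext => h; rewrite /d /d' /=.
by rewrite [h *: (0, 1)](_ : _ = (h * 0, h * 1))// mulr1 mulr0
  [(0, h) + (s, t)](_ : _ = (0 + s, h + t))// add0r.
Qed.

End Smooth.

Section Connection.
Variables (R : realType) (V : jbAlgType R).
Implicit Types (g A B C X Y Z : bop V) (c mu nu : R -> bop V) (J : set R).

(** Twice the Christoffel map in the left trivialization of the tangent bundle. *)
Definition conn X Y : bop V :=
  X * Y + Y * X + dagger X * Y + dagger Y * X - X * dagger Y - Y * dagger X.

Lemma conn_sym X Y : conn X Y = conn Y X.
Proof. by rewrite /conn; lmod_over R (bop V). Qed.

Lemma conn_bb : bounded_bilinear conn.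
Proof.
have lin Y a X X' : conn (a *: X + X') Y = a *: conn X Y + conn X' Y.
  rewrite /conn daggerZD; move: (dagger X) (dagger Y) (dagger X') => x y x'.
  by bop_ring R V.
have [_ [k0 hk0]] := bounded_lin_dagger V.
pose k := `|k0|; have hk X : `|dagger X| <= k * `|X|.
  by rewrite (le_trans (hk0 X))// ler_wpM2r// ler_norm.
split=> [Y a X X'|X a Y Y'|]; first exact: lin.
  by rewrite !(conn_sym X) lin.
exists (2 + 4 * k) => X Y.
have b X' Y' K L : `|X'| <= K -> `|Y'| <= L -> `|X' * Y'| <= K * L.
  by move=> hK hL; rewrite (le_trans (bop_normM _ _))// ler_pM.
have -> : (2 + 4 * k) * `|X| * `|Y| = `|X| * `|Y| + `|Y| * `|X|
  + k * `|X| * `|Y| + k * `|Y| * `|X| + `|X| * (k * `|Y|) + `|Y| * (k * `|X|) by ring.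
rewrite /conn; do 2!(rewrite (le_trans (ler_normB _ _))// lerD//; last exact: b).
by do 3!(rewrite (le_trans (ler_normD _ _))// lerD//; last exact: b); exact: b.
Qed.

Lemma ChristoffelE g A B :
  Christoffel V g A B = 2^-1 *: (g * conn (binv g * A) (binv g * B)).
Proof.
rewrite /Christoffel /spray (mulrDr (binv g) A B); move: (_ * A) (_ * B) => X Y.
rewrite daggerD /conn; move: (dagger X) (dagger Y) => x y.
by bop_ring R V.
Qed.

Lemma DtE c mu t :
  Dt V c mu t = derive1 mu t - Christoffel V (c t) (derive1 c t) (mu t).
Proof. by rewrite ChristoffelE. Qed.

(** The correction that turns the derivative of Y = c^-1 mu into the
    trivialized covariant derivative. *)
Definition conn_op X Y : bop V := X * Y - 2^-1 *: conn X Y.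

Lemma conn_opE X Y : conn_op X Y =
  2^-1 *: (bracket X Y - bracket (dagger X) Y - bracket (dagger Y) X).
Proof.
rewrite /conn_op /conn /bracket; move: (dagger X) (dagger Y) => x y.
by bop_ring R V.
Qed.

(* Otherwise distributivity would look inside [conn] and [dagger] when rewriting. *)
Local Opaque conn dagger.

Lemma Christoffel_bb g : bounded_bilinear (Christoffel V g).
Proof.
have [lc _ [K hK]] := conn_bb; have [_ lr _] := conn_bb.
split=> [B a A A'|A a B B'|].
- rewrite !ChristoffelE (mulrDr (binv g)) bop_scaleAr lc (mulrDr g) bop_scaleAr.
  by lmod_over R (bop V).
- rewrite !ChristoffelE (mulrDr (binv g)) bop_scaleAr lr (mulrDr g) bop_scaleAr.
  by lmod_over R (bop V).
exists (`|g| * (`|K| * `|binv g| * `|binv g|)) => A B.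
rewrite ChristoffelE normrZ (@le_trans _ _ (1 * `|g * conn (binv g * A) (binv g * B)|))//.
  by rewrite ler_wpM2r// ger0_norm// invf_le1// ler1n.
rewrite mul1r (le_trans (bop_normM _ _))// -!mulrA ler_wpM2l//.
rewrite (le_trans (hK _ _))//.
rewrite (@le_trans _ _ (`|K| * `|binv g * A| * `|binv g * B|))//.
  by rewrite ler_wpM2r// ler_wpM2r// ler_norm.
rewrite -mulrA ler_wpM2l//.
have -> : `|binv g| * (`|binv g| * (`|A| * `|B|)) =
  (`|binv g| * `|A|) * (`|binv g| * `|B|) by ring.
by rewrite ler_pM// bop_normM.
Qed.

Lemma tangentP g A : GL g -> tangent V g A <-> str_set (binv g * A).
Proof.
move=> gG; split=> [[H [hH ->]]|hA]; first by rewrite mulrA binvKl// mul1r.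
by exists (binv g * A); rewrite mulrA binvK// mul1r.
Qed.

Lemma Cn_conn n J (X Y : R -> bop V) : open J -> Cn n J X -> Cn n J Y ->
  Cn n J (fun t => conn (X t) (Y t)).
Proof. exact: (Cn_bilin conn_bb). Qed.

Section AlongPath.
Variables (J : set R) (c : R -> bop V).
Hypothesis Jc : path_in (Str V) J c.

Let oJ : open J. Proof. by case: Jc => -[]. Qed.
Let cS t : J t -> Str V (c t). Proof. by case: Jc => _ _; exact. Qed.
Let cG t : J t -> GL (c t). Proof. by move=> /cS/Str_GL. Qed.
Let sc : smooth_on J c. Proof. by case: Jc. Qed.

Lemma path_binv_smooth mu : smooth_on J mu -> smooth_on J (fun t => binv (c t) * mu t).
Proof. by move=> sm n; apply: CnM => //; apply: Cn_binv. Qed.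

Lemma velocity_field : field_along (tangent V) J c (derive1 c).
Proof.
split=> [n|t Jt]; first exact: Cn_derive1.
apply/tangentP; first exact: cG.
exact: Str_velocity Jt cS (smooth_is_derive sc Jt).
Qed.

Lemma Christoffel_smooth mu nu : smooth_on J mu -> smooth_on J nu ->
  smooth_on J (fun t => Christoffel V (c t) (mu t) (nu t)).
Proof.
move=> sm sn n.
apply: (@Cn_eq _ _ _ _ _ (fun t =>
  2^-1 *: (c t * conn (binv (c t) * mu t) (binv (c t) * nu t)))) => //.
  by move=> t _; rewrite ChristoffelE.
by apply: CnZ => //; apply: CnM => //; apply: Cn_conn => //; apply: path_binv_smooth.
Qed.

Lemma conn_op_str X Y : str_set X -> str_set Y -> str_set (conn_op X Y).
Proof.
move=> hX hY; rewrite conn_opE; apply: strZ.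
by do 2!(apply: strB; last by apply: str_bracket => //; exact: str_dagger);
  exact: str_bracket.
Qed.

Lemma Dt_trivialized mu (t : R) : smooth_on J mu -> J t ->
  Dt V c mu t = c t * (derive1 (fun s => binv (c s) * mu s) t +
    conn_op (binv (c t) * derive1 c t) (binv (c t) * mu t)).
Proof.
move=> sm Jt.
have Yd := smooth_is_derive (path_binv_smooth sm) Jt.
have cd := smooth_is_derive sc Jt.
have : is_derive t 1 mu (derive1 c t * (binv (c t) * mu t) +
    c t * derive1 (fun s => binv (c s) * mu s) t).
  apply: (near_eq_is_derive _ (is_derive_mul cd Yd)).
  have := open_nbhs_nbhs (conj oJ Jt); apply: filterS => s Js.
  by rewrite mulrA binvK ?mul1r//; exact: cG.
move=> /is_derive_derive1 mud.
rewrite DtE mud ChristoffelE /conn_op.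
set Y := binv (c t) * mu t; set X := binv (c t) * derive1 c t.
have -> : derive1 c t = c t * X by rewrite /X mulrA binvK ?mul1r//; exact: cG.
move: (derive1 _ t) (conn _ _) => Y' Z; clearbody X Y.
by bop_ring R V.
Qed.

Lemma Dt_field mu : field_along (tangent V) J c mu ->
  field_along (tangent V) J c (Dt V c mu).
Proof.
move=> [sm tm]; split=> [n|t Jt].
  apply: (@Cn_eq _ _ _ _ _ (fun t =>
    derive1 mu t - Christoffel V (c t) (derive1 c t) (mu t))) => //.
    by move=> t _; rewrite DtE.
  apply: CnB => //; first exact: Cn_derive1.
  by apply: Christoffel_smooth => //; case: velocity_field.
rewrite Dt_trivialized//; eexists; split; last by [].
have strY s : J s -> str_set (binv (c s) * mu s).
  by move=> Js; apply/tangentP; [exact: cG|exact: tm].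
apply: strD.
  apply: (is_derive_str oJ Jt strY).
  exact: (smooth_is_derive (path_binv_smooth sm) Jt).
apply: conn_op_str; last exact: strY.
apply/tangentP; [exact: cG|by case: velocity_field => _; exact].
Qed.

End AlongPath.

Lemma Dt_torsion_free :
  torsion_free_covariant_derivative (Str V) (tangent V) (Christoffel V) (Dt V).
Proof.
split.
- by move=> J c; exact: velocity_field.
- by move=> g A B _ _ _; rewrite !ChristoffelE conn_sym.
- by move=> g a A B C _ _ _ _; have [h _ _] := Christoffel_bb g; exact: h.
- by move=> g _; have [_ _ [K hK]] := Christoffel_bb g; exists K.
- by move=> J c mu nu Jc [sm _] [sn _]; exact: (Christoffel_smooth Jc).
- by move=> J c mu t _ _ _; exact: DtE.
- by move=> J c mu Jc f; exact: (Dt_field Jc f).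
- move=> J c mu nu a t Jc [sm _] [sn _] Jt; rewrite !DtE.
  have [_ lr _] := Christoffel_bb (c t); rewrite lr.
  have := is_derive_add (is_derive_lin (scale_bounded_lin (bop V) a)
    (smooth_is_derive sm Jt)) (smooth_is_derive sn Jt).
  by move=> /is_derive_derive1 ->; lmod_over R (bop V).
- move=> J c mu f t Jc [sm _] sf Jt; rewrite !DtE.
  rewrite (bbZr (Christoffel_bb (c t))).
  have := is_derive_bilin (scale_bounded_bilinear (bop V))
    (smooth_is_derive sf Jt) (smooth_is_derive sm Jt).
  by move=> /is_derive_derive1 ->; lmod_over R (bop V).
move=> U Phi s t oU sPhi _ Ust; rewrite !DtE.
rewrite (derive1_slice1 ('D_(0, 1) Phi)) (derive1_slice1 Phi).
rewrite (derive1_slice2 ('D_(1, 0) Phi)) (derive1_slice2 Phi).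
rewrite (schwarz ((1, 0) : R * R) ((0, 1) : R * R) oU (sPhi 2%N) Ust).
by rewrite !ChristoffelE (conn_sym (_ * 'D_(1, 0) Phi _)).
Qed.

End Connection.

(** * Geodesics and parallel transport *)

Section Automorphisms.
Variables (R : realType) (V : jbAlgType R) (D : bop V).
Hypothesis hD : Der D.
Implicit Types (x y : V) (t : R) (H : bop V).

(** The exponential of a derivation is an automorphism of the algebra. *)
Lemma bexp_Der_Lop t x :
  bexp (t *: D) * Lop x = Lop (bexp (t *: D) x) * bexp (t *: D).
Proof.
pose z (s : R) := bexp (s *: D) x.
pose F (s : R) := bexp (- s *: D) * Lop (z s) * bexp (s *: D).
have zd (s : R) : is_derive s 1 z (D (z s)).
  have := is_derive_bilin (bop_apply_bb V) (bexp_derive D s) (is_derive_cst x s 1).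
  by rewrite /cst bop0 addr0.
have Fd (s : R) : setT s -> is_derive s 1 F 0.
  move=> _; apply: is_derive_eq.
    apply: is_derive_mul (bexp_derive D s).
    exact: is_derive_mul (bexp_scaleN_derive D s)
      (is_derive_lin (bounded_lin_Lop V) (zd s)).
  cbv beta; rewrite -(bexp_scale_comm D (- s)).
  have -> : Lop (D (z s)) = D * Lop (z s) - Lop (z s) * D.
    by rewrite Der_Lop// addrK.
  set E := bexp (- s *: D); set E' := bexp (s *: D).
  rewrite /comp; move: (Lop (z s)) => l; clearbody E E'.
  by bop_ring R V.
have : F t = F 0 by exact: (@derive0_constant _ _ setT).
rewrite /F /z oppr0 !scale0r !bexp0 mul1r mulr1 bop1E => <-.
by rewrite !mulrA bexpN mul1r.
Qed.

Lemma bexp_Der_jmul t x y :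
  bexp (t *: D) (x *j y) = bexp (t *: D) x *j bexp (t *: D) y.
Proof.
have /(congr1 (fun f : bop V => f y)) := bexp_Der_Lop t x.
by rewrite !bopME !LopE.
Qed.

(** Conjugation by an automorphism preserves both summands of str(V), hence commutes
    with [dagger]. *)
Lemma bexp_Der_conj t H : str_set H ->
  str_set (bexp (- t *: D) * H * bexp (t *: D)) /\
  dagger (bexp (- t *: D) * H * bexp (t *: D)) =
    bexp (- t *: D) * dagger H * bexp (t *: D).
Proof.
move=> [x [D' [hD' ->]]]; rewrite daggerE// mulrDr mulrDl mulrBr mulrBl.
have -> : bexp (- t *: D) * Lop x * bexp (t *: D) = Lop (bexp (- t *: D) x).
  by rewrite bexp_Der_Lop -mulrA bexpNl mulr1.
have hC : Der (bexp (- t *: D) * D' * bexp (t *: D)).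
  have e w : bexp (- t *: D) (bexp (t *: D) w) = w by rewrite -bopME bexpNl.
  move: (bexp_Der_jmul t) (bexp_Der_jmul (- t)) e.
  move: (bexp (- t *: D)) (bexp (t *: D)) => q p pm qm e u v.
  by rewrite !bopME pm hD' bopD !qm !e.
by split; [exists (bexp (- t *: D) x), (bexp (- t *: D) * D' * bexp (t *: D))|
  exact: daggerE].
Qed.

Lemma ad_exp (t : R) (Z : str V) : 
  str_val (bexp (t *: ad (str_D hD)) Z) =
  bexp (t *: D) * str_val Z * bexp (- t *: D).
Proof.
set d := ad _.
pose z (s : R) := str_val (bexp (s *: d) Z).
pose F (s : R) := bexp (- s *: D) * z s * bexp (s *: D).
have zd (s : R) : is_derive s 1 z (D * z s - z s * D).
  have := is_derive_bilin (bop_apply_bb (str V)) (bexp_derive d s)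
    (is_derive_cst Z s 1).
  by rewrite /cst bop0 addr0 => /(is_derive_lin (str_val_bounded_lin V)).
have Fd (s : R) : setT s -> is_derive s 1 F 0.
  move=> _; apply: is_derive_eq.
    apply: is_derive_mul (bexp_derive D s).
    exact: is_derive_mul (bexp_scaleN_derive D s) (zd s).
  cbv beta; rewrite -(bexp_scale_comm D (- s)).
  set E := bexp (- s *: D); set E' := bexp (s *: D).
  move: (z s) => l; clearbody E E'.
  by bop_ring R V.
have : F t = F 0 by exact: (@derive0_constant _ _ setT).
rewrite /F /z oppr0 !scale0r !bexp0 mul1r mulr1 bop1E => <-.
by rewrite !mulrA bexpN mul1r -mulrA bexpN mulr1.
Qed.

End Automorphisms.

Section RingCancellation.
Variable A : pzRingType.
Implicit Types a b c d e x : A.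

Lemma mul_cancel2 a b c d : b * c = 1 -> a * b * (c * d) = a * d.
Proof. by move=> bc; rewrite mulrA -(mulrA a) bc mulr1. Qed.

Lemma mul_cancel3 a b c d e : b * c = 1 -> a * b * (c * d * e) = a * d * e.
Proof. by move=> bc; rewrite mulrA mul_cancel2. Qed.

Lemma mul_sandwich a b c d x : a * b = 1 -> c * d = 1 -> a * (b * x * c) * d = x.
Proof. by move=> ab cd; rewrite !mulrA ab mul1r -mulrA cd mulr1. Qed.

Lemma mul_conj_sub s p q l d e : q * p = 1 -> q * d = d * q ->
  s * q * ((p * l * q - d) * e) = s * (l - d) * q * e.
Proof.
move=> qp qd; rewrite mulrA; congr (_ * e).
by rewrite mulrBr mul_cancel3// -(mulrA s q d) qd (mulrA s d q) mulrBr mulrBl.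
Qed.

End RingCancellation.

Section Transport.
Variables (R : realType) (V : jbAlgType R) (y : V) (D g : bop V).
Hypotheses (hD : Der D) (hg : Str V g).
Implicit Types (t s : R) (Z : R -> bop V).

Local Notation L := (Lop y).
Local Notation W := (Lop y + D).
Local Notation D2 := (2 *: D).

(* The geodesic is c = K P, and a field along it is written K Z P. Its trivialization
   c^-1 K Z P is then Z conjugated by the automorphism P, so that all the equations
   along c turn into equations with constant coefficients for Z. *)
Let K t : bop V := g * bexp (t *: (L - D)).
Let K' t : bop V := bexp (- t *: (L - D)) * binv g.
Let P t : bop V := bexp (t *: D2).
Let Q t : bop V := bexp (- t *: D2).
Let c t : bop V := K t * P t.

Let hD2 : Der D2. Proof. by have [_ _ h] := Der_submod_closed V; exact: h. Qed.
Let gG : GL g := Str_GL hg.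
Let KK t : K t * K' t = 1.
Proof. by rewrite /K /K' mul_cancel2 ?bexpN// binvK. Qed.
Let KK' t : K' t * K t = 1.
Proof. by rewrite /K /K' mul_cancel2 ?binvKl// bexpNl. Qed.
Let PQ t : P t * Q t = 1. Proof. exact: bexpN. Qed.
Let QP t : Q t * P t = 1. Proof. exact: bexpNl. Qed.
Let DP t : P t * D = D * P t.
Proof. by apply: bexp_comm; rewrite !(bop_scaleAl, bop_scaleAr). Qed.
Let DQ t : Q t * D = D * Q t.
Proof. by apply: bexp_comm; rewrite !(bop_scaleAl, bop_scaleAr). Qed.

Let strW : str_set W. Proof. by exists y, D. Qed.
Let daggerW : dagger W = L - D. Proof. exact: daggerE. Qed.

Let Kd t : is_derive t 1 K (K t * (L - D)).
Proof.
have := is_derive_mull g (bexp_derive (L - D) t).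
by rewrite -bexp_scale_comm mulrA.
Qed.
Let Pd t : is_derive t 1 P (D2 * P t). Proof. exact: bexp_derive. Qed.
Let Qd t : is_derive t 1 Q (- (D2 * Q t)). Proof. exact: bexp_scaleN_derive. Qed.

Let binvc t : binv (c t) = Q t * K' t.
Proof.
by apply: binv_unique; rewrite /c mul_cancel2.
Qed.

Let KZP_derive Z t (Z' : bop V) : is_derive t 1 Z Z' ->
  is_derive t 1 (fun s => K s * Z s * P s)
    (K t * ((L - D) * Z t + Z' + 2 *: (Z t * D)) * P t).
Proof.
move=> Zd; apply: (is_derive_eq (is_derive_mul (is_derive_mul (Kd t) Zd) (Pd t))).
move: (K t) (P t) (L) (Z t) => k p l z.
by bop_ring R V.
Qed.

Let cd t : is_derive t 1 c (K t * W * P t).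
Proof.
apply: (is_derive_eq (is_derive_mul (Kd t) (Pd t))).
move: (K t) (P t) (L) => k p l.
by bop_ring R V.
Qed.

(** The right-hand side of the transport equation in the frame of [c] turned by
    the automorphisms exp(2tD). *)
Definition transport_rhs (l d H : bop V) : bop V :=
  2^-1 *: (bracket d (Lpart H) + bracket l (Dpart H)
    - bracket l (Lpart H) + 3 *: bracket d (Dpart H)).

(** The terms that come from the derivatives of K and P combine with the Christoffel
    term to the block matrix of the transport operator. *)
Let transport_identity H : str_set H ->
  (L - D) * H + 2 *: (H * D) - 2^-1 *: conn W H = - transport_rhs L D H.
Proof.
move=> [x [B [hB ->]]]; rewrite /conn /transport_rhs daggerW daggerE// LpartE// DpartE//.
rewrite /bracket; move: (L) (Lop x) => l a.
by bop_ring R V.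
Qed.

Let conn_conj t H H' : str_set H -> str_set H' ->
  conn (Q t * H * P t) (Q t * H' * P t) = Q t * conn H H' * P t.
Proof.
move=> hH hH'; rewrite /conn.
have [_ ->] := bexp_Der_conj hD2 t hH; have [_ ->] := bexp_Der_conj hD2 t hH'.
rewrite -/(Q t) -/(P t).
have col (A B : bop V) : Q t * A * P t * (Q t * B * P t) = Q t * (A * B) * P t.
  by rewrite mul_cancel3 ?PQ// -(mulrA (Q t) A B).
rewrite !col; move: (dagger H) (dagger H') (Q t) (P t) => h h' q p.
by bop_ring R V.
Qed.

Let Dt_KZP Z (nu : R -> bop V) t (Z' : bop V) :
  is_derive t 1 Z Z' -> str_set (Z t) ->
  (\near t, K t * Z t * P t = nu t) ->
  Dt V c nu t = K t * (Z' - transport_rhs L D (Z t)) * P t.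
Proof.
move=> Zd hZ nuE.
have nud := is_derive_derive1 (near_eq_is_derive nuE (KZP_derive Zd)).
rewrite DtE nud (is_derive_derive1 (cd t)) ChristoffelE binvc.
have -> : nu t = K t * Z t * P t by rewrite (nbhs_singleton nuE).
have col (A : bop V) : Q t * K' t * (K t * A * P t) = Q t * A * P t.
  exact: mul_cancel3.
rewrite !col (conn_conj t strW hZ) /c.
have -> : K t * P t * (Q t * conn W (Z t) * P t) = K t * conn W (Z t) * P t.
  exact: mul_cancel3.
rewrite -[transport_rhs _ _ _]opprK -(transport_identity hZ).
move: (conn W (Z t)) => w; move: (K t) (P t) (L) (Z t) => k p l z.
by bop_ring R V.
Qed.

Let transport_rhs_W : transport_rhs L D W = 0.
Proof.
rewrite /transport_rhs LpartE// DpartE// /bracket; move: (L) => l.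
by bop_ring R V.
Qed.

Let smoothK n : Cn n setT K.
Proof.
by apply: CnM; [exact: openT|apply: Cn_cst; exact: openT|exact: Cn_bexp].
Qed.
Let smoothP n : Cn n setT P. Proof. exact: Cn_bexp. Qed.

Let StrK t : Str V (K t).
Proof.
apply: Str_mul => //; apply: Str_bexp; rewrite -daggerW; exact: str_dagger.
Qed.

Let StrP t : Str V (P t). Proof. by apply: Str_bexp; exact: Der_str. Qed.

Let path_c : path_in (Str V) setT c.
Proof.
split; first by split; [exact: openT|].
- by move=> n; apply: CnM => //; exact: openT.
- by move=> t _; exact: Str_mul.
Qed.

Lemma exp_geodesic : geodesic_from (Str V) (Dt V) setT
  (fun t => g * bexp (t *: (L - D)) * bexp ((2 * t) *: D)) g (g * W).
Proof.
have -> : (fun t => g * bexp (t *: (L - D)) * bexp ((2 * t) *: D)) = c.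
  by apply/funext => t; rewrite /c /K /P scalerA (mulrC t).
have c'E : derive1 c = fun t => K t * W * P t.
  by apply/funext => t; exact: (is_derive_derive1 (cd t)).
split=> //.
- split=> // t _.
  rewrite (@Dt_KZP (fun=> W) _ t 0)//.
  + by rewrite sub0r transport_rhs_W oppr0 mulr0 mul0r.
  + by rewrite c'E; near=> s.
- by rewrite /c /K /P !scale0r !bexp0 !mulr1.
- by rewrite c'E /K /P !scale0r !bexp0 !mulr1.
Unshelve. all: by end_near. Qed.

(** The velocity X = l + d of a geodesic satisfies X' = 2 [l, d], which lies in the
    first summand of str(V). Thus d = D is constant, l is the conjugate of its initial
    value by e^(-2tD), and s e^(-2tD) e^(-t (L - D)) has derivative zero. *)
Lemma geodesic_unique (J : set R) (s : R -> bop V) :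
  geodesic_from (Str V) (Dt V) J s g (g * W) -> forall t, J t -> s t = c t.
Proof.
move=> [[Js Ds] J0 s0 s'0]; have [[oJ iJ] sm sS] := Js.
have sG t : J t -> GL (s t) by move=> /sS/Str_GL.
pose X t := binv (s t) * derive1 s t.
have [sm' tan'] := velocity_field Js.
have strX t : J t -> str_set (X t).
  by move=> Jt; apply/tangentP; [exact: sG|exact: tan'].
have Xd t : J t -> is_derive t 1 X (2 *: bracket (Lpart (X t)) (Dpart (X t))).
  move=> Jt; have Xt := smooth_is_derive (path_binv_smooth Js sm') Jt.
  apply: (is_derive_eq Xt).
  have := Ds t Jt; rewrite (Dt_trivialized Js sm' Jt) => e.
  have : binv (s t) * (s t * (derive1 X t + conn_op (X t) (X t))) = 0.
    by rewrite e mulr0.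
  rewrite mulrA binvKl ?mul1r; last exact: sG.
  move=> /eqP; rewrite addr_eq0 => /eqP ->; rewrite conn_opE.
  have [x [B [hB ->]]] := strX t Jt.
  rewrite daggerE// LpartE// DpartE// /bracket; move: (Lop x) => l.
  by bop_ring R V.
have s'X t : J t -> is_derive t 1 s (s t * X t).
  move=> Jt; rewrite /X mulrA binvK ?mul1r; last exact: sG.
  exact: smooth_is_derive sm Jt.
have X0 : X 0 = W by rewrite /X s0 s'0 mulrA binvKl// mul1r.
have brL t : J t -> exists z, bracket (Lpart (X t)) (Dpart (X t)) = Lop z.
  move=> Jt; have [x [B [hB ->]]] := strX t Jt.
  by rewrite LpartE// DpartE// bracketLD//; exists (- B x); rewrite LopN.
have D0 : Der (0 : bop V) by have [] := Der_submod_closed V.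
have DX t : J t -> Dpart (X t) = D.
  move=> Jt; rewrite -[RHS](DpartE y hD) -X0.
  apply: (@derive0_constant _ _ J (fun t => Dpart (X t))) => // {t Jt} t Jt.
  apply: (is_derive_eq (is_derive_lin (bounded_lin_Dpart V) (Xd t Jt))).
  have [z ->] := brL t Jt.
  by rewrite -LopZ -[Lop _]addr0 DpartE.
have lXd t : J t -> is_derive t 1 (fun t => Lpart (X t))
    (2 *: bracket (Lpart (X t)) D).
  move=> Jt.
  apply: (is_derive_eq (is_derive_lin (bounded_lin_Lpart V) (Xd t Jt))).
  rewrite DX//; have [z] := brL t Jt; rewrite DX// => ->.
  by rewrite -LopZ -[Lop _]addr0 LpartE// addr0.
have LX t : J t -> P t * Lpart (X t) * Q t = L.
  move=> Jt; have <- : P 0 * Lpart (X 0) * Q 0 = L.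
    by rewrite /P /Q oppr0 !scale0r bexp0 mul1r mulr1 X0 LpartE.
  apply: (@derive0_constant _ _ J (fun t => P t * Lpart (X t) * Q t)) => //.
  move=> {t Jt} t Jt.
  apply: (is_derive_eq (is_derive_mul (is_derive_mul (Pd t) (lXd t Jt)) (Qd t))).
  rewrite bop_scaleAl -(DP t) /bracket.
  move: (P t) (Q t) (Lpart (X t)) => p q l.
  by bop_ring R V.
have const t : J t -> s t * Q t * bexp (- t *: (L - D)) = g.
  move=> Jt; have <- : s 0 * Q 0 * bexp (- 0 *: (L - D)) = g.
    by rewrite /Q oppr0 !scale0r !bexp0 !mulr1.
  apply: (@derive0_constant _ _ J
    (fun t => s t * Q t * bexp (- t *: (L - D)))) => // {t Jt} t Jt.
  apply: (is_derive_eq (is_derive_mul (is_derive_mul (s'X t Jt) (Qd t))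
    (bexp_scaleN_derive (L - D) t))).
  have -> : X t = Lpart (X t) + D by rewrite {1}[X t]Lpart_Dpart DX.
  have -> : s t * Q t * - ((L - D) * bexp (- t *: (L - D))) =
      - (s t * (Lpart (X t) - D) * Q t * bexp (- t *: (L - D))).
    by rewrite mulrN -(LX t Jt) (mul_conj_sub _ _ _ (QP t) (DQ t)).
  rewrite bop_scaleAl.
  set E := bexp _; move: (s t) (Q t) (Lpart (X t)) => a q l; clearbody E.
  by bop_ring R V.
move=> t Jt; rewrite /c /K -(const t Jt) -(mulrA _ _ (bexp (t *: _))) bexpNl mulr1.
by rewrite -mulrA QP mulr1.
Qed.

(** In the frame turned by e^(2tD), a field is parallel exactly when it satisfies the
    linear equation Z' = M Z with constant coefficients; for any solution,
    e^(-tM) Z has derivative zero. *)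
Lemma parallel_exp (mu0 : bop V) (Z0 : str V) :
  str_val Z0 = binv g * mu0 ->
  let M := transport_op (str_L y) (str_D hD) in
  let mu t := c t *
    str_val (bexp (- (2 * t) *: ad (str_D hD)) (bexp (t *: M) Z0)) in
  [/\ parallel (tangent V) (Dt V) setT c mu, mu 0 = mu0 &
      forall (J : set R) (nu : R -> bop V), open_interval J -> J 0 ->
        parallel (tangent V) (Dt V) J c nu -> nu 0 = mu0 ->
        forall t, J t -> nu t = mu t].
Proof.
move=> Z0E M mu.
have MZ (Z : str V) : str_val (M Z) = transport_rhs L D (str_val Z).
  have [x [B [hB ZE]]] := strP Z.
  have LZ : Lpart (str_val Z) = Lop x by rewrite ZE LpartE.
  have DZ : Dpart (str_val Z) = B by rewrite ZE DpartE.
  have D0 : Der (0 : bop V) by have [] := Der_submod_closed V.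
  have LpL (z : V) : Lpart (Lop z) = Lop z by have := LpartE z D0; rewrite addr0.
  have DpD (B' : bop V) : Der B' -> Dpart B' = B'.
    move=> hB'; have L0 : Lop (0 : V) = 0.
      by rewrite -(scale0r (0 : V)) LopZ scale0r.
    by rewrite /Dpart /Lpart Der1// L0 subr0.
  have -> : str_val (M Z) = 2^-1 *: (Lpart (bracket D (Lpart (str_val Z))) +
     Lpart (bracket L (Dpart (str_val Z))) + Dpart (- bracket L (Lpart (str_val Z)))
     + Dpart (3 *: bracket D (Dpart (str_val Z)))) by [].
  have [_ _ DerZ] := Der_submod_closed V.
  have h1 : Lpart (bracket D (Lop x)) = bracket D (Lop x).
    have -> : bracket D (Lop x) = Lop (D x); last exact: LpL.
    by rewrite -[RHS]opprK -bracketLD// /bracket opprB.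
  have h2 : Lpart (bracket L B) = bracket L B.
    by rewrite bracketLD// -LopN LpL.
  have h3 : Dpart (- bracket L (Lop x)) = - bracket L (Lop x).
    by apply: DpD; rewrite -scaleN1r; apply: DerZ; exact: Der_bracketL.
  have h4 : Dpart (3 *: bracket D B) = 3 *: bracket D B.
    by apply: DpD; apply: DerZ; exact: Der_bracket.
  by rewrite /transport_rhs LZ DZ h1 h2 h3 h4.
pose z t := str_val (bexp (t *: M) Z0).
have muE t : mu t = K t * z t * P t.
  rewrite /mu ad_exp -/(z t) /c opprK.
  have -> : bexp (- (2 * t) *: D) = Q t by rewrite /Q scalerA mulNr (mulrC t).
  have -> : bexp ((2 * t) *: D) = P t by rewrite /P scalerA (mulrC t).
  exact: mul_cancel3.
have zd t : is_derive t 1 z (transport_rhs L D (z t)).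
  have := is_derive_bilin (bop_apply_bb (str V)) (bexp_derive M t)
    (is_derive_cst Z0 t 1).
  rewrite /cst bop0 addr0 => /(is_derive_lin (str_val_bounded_lin V)).
  by rewrite bopME MZ.
have smooth_z n : Cn n setT z.
  apply: (Cn_lin (str_val_bounded_lin V)); first exact: openT.
  apply: (Cn_bilin (bop_apply_bb (str V))); first exact: openT.
    exact: Cn_bexp.
  by apply: Cn_cst; exact: openT.
have cG t : GL (c t) by apply: Str_GL; case: path_c => _ _; exact.
split.
- split; [split=> [n|t _]|move=> t _].
  + apply: (@Cn_eq _ _ _ _ _ (fun t => K t * z t * P t)); first exact: openT.
      by move=> t _; rewrite muE.
    by do 2!(apply: CnM => //; first exact: openT).
  + by eexists; split; last by []; exact: strP.
  + rewrite (@Dt_KZP z _ t (transport_rhs L D (z t)))//.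
    * by rewrite subrr mulr0 mul0r.
    * exact: strP.
    * by near=> s; rewrite muE.
- rewrite muE /K /P /z !scale0r !bexp0 bop1E !mulr1 Z0E mulrA binvK// mul1r.
  by [].
move=> J nu [oJ iJ] J0 [[sn tn] Dn] nu0.
pose Z t := K' t * nu t * Q t.
have nuE t : nu t = K t * Z t * P t.
  by rewrite /Z mul_sandwich.
have strZ' t : J t -> str_set (Z t).
  move=> Jt; have /(tangentP _ (cG t)) := tn t Jt; rewrite binvc => hY.
  have [+ _] := bexp_Der_conj hD2 (- t) hY.
  by rewrite opprK -/(P t) -/(Q t) -(mulrA (Q t) (K' t)) (mulrA (P t)) PQ mul1r.
(* Z takes values in str(V) on J only; elsewhere the value 0 of Zs is irrelevant. *)
pose Zs t := insubd (0 : str V) (Z t).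
have ZsE t : J t -> str_val (Zs t) = Z t.
  by move=> Jt; rewrite /Zs insubdK//; apply/asboolP; exact: strZ'.
have Zd t : J t -> is_derive t 1 Z (transport_rhs L D (Z t)).
  move=> Jt; have sK' : derivable K' t 1.
    by have [] := is_derive_mulr (binv g) (bexp_scaleN_derive (L - D) t).
  have sZ := is_derive_mul (is_derive_mul (derivableP sK') (smooth_is_derive sn Jt)) (Qd t).
  apply: (is_derive_eq sZ).
  have := Dn t Jt; rewrite (Dt_KZP sZ (strZ' t Jt)); last by near=> s; exact: (esym (nuE s)).
  move=> e; apply/eqP; rewrite -subr_eq0.
  by rewrite -[X in X == _](mul_sandwich _ (KK' t) (PQ t)) e mulr0 mul0r.
have Zsd t : J t -> is_derive t 1 Zs (M (Zs t)).
  move=> Jt; apply/is_derive_str_val; rewrite MZ ZsE//.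
  apply: (near_eq_is_derive _ (Zd t Jt)).
  by have := open_nbhs_nbhs (conj oJ Jt); apply: filterS => s Js; rewrite ZsE.
have const t : J t -> bexp (- t *: M) (Zs t) = Z0.
  move=> Jt; have -> : Z0 = bexp (- 0 *: M) (Zs 0).
    rewrite oppr0 scale0r bexp0 bop1E; apply: val_inj.
    rewrite -[RHS]/(str_val (Zs 0)) -[LHS]/(str_val Z0) ZsE// /Z Z0E nu0.
    by rewrite /K' /Q oppr0 !scale0r !bexp0 mul1r mulr1.
  apply: (@derive0_constant _ _ J (fun t => bexp (- t *: M) (Zs t))) => //.
  move=> {t Jt} t Jt.
  apply: (is_derive_eq (is_derive_bilin (bop_apply_bb (str V))
    (bexp_scaleN_derive M t) (Zsd t Jt))).
  by rewrite -bexp_scale_comm bopNE bopME addNr.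
move=> t Jt; rewrite nuE muE; congr (_ * _ * _).
by rewrite /z -(const t Jt) -bopME bexpN bop1E ZsE.
Unshelve. all: by end_near. Qed.

End Transport.

(** * The left-invariant metric *)

Section TraceMetric.
Variables (R : realType) (V : jbAlgType R) (tr : bop V -> R).
Hypotheses (tr_bl : bounded_lin tr) (trC : forall A B, tr (A * B) = tr (B * A)).
Implicit Types (A B H X Y Z : bop V).

Lemma trD A B : tr (A + B) = tr A + tr B.
Proof. by have [/(_ 1 A B)] := tr_bl; rewrite !scale1r. Qed.

Lemma tr0 : tr 0 = 0.
Proof. by apply: (addrI (tr 0)); rewrite -trD !addr0. Qed.

Lemma trZ a A : tr (a *: A) = a * tr A.
Proof. by have [/(_ a A 0)] := tr_bl; rewrite tr0 !addr0. Qed.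

Lemma trN A : tr (- A) = - tr A.
Proof. by rewrite -scaleN1r trZ mulN1r. Qed.

Lemma tr_bracket A B : tr (bracket A B) = 0.
Proof. by rewrite /bracket trD trN trC subrr. Qed.

Lemma tr_Lop_Der D x : Der D -> tr (Lop (D x)) = 0.
Proof.
by move=> hD; rewrite -[Lop _]opprK -bracketLD// trN tr_bracket oppr0.
Qed.

(** Traces of the operators L_(D x) vanish, as they are commutators. This makes
    derivations skew, and it makes every L_x symmetric, since
    (x o v) o w - v o (x o w) is the image of x under the derivation [L_w, L_v]. *)
Lemma trace_form_adjoint H v w : str_set H ->
  trace_form tr (H v) w = trace_form tr v (dagger H w).
Proof.
move=> [x [D [hD ->]]]; rewrite daggerE// /trace_form.
rewrite !(bopDE, bopNE, LopE, jmulDl, jmulDr, jmulNr, LopD, LopN, trD, trN).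
have := tr_Lop_Der (v *j w) hD; rewrite hD LopD trD.
have := tr_Lop_Der x (Der_bracketL w v).
rewrite /bracket bopDE bopNE !bopME !LopE LopD LopN trD trN.
rewrite (jmulC v x) (jmulC w (x *j v)) (jmulC w x) => e1 e2.
lra.
Qed.

Definition mform X Y : R := 2^-1 * tr (X * dagger Y + Y * dagger X).

Lemma str_metricE g A B : str_metric tr g A B = mform (binv g * A) (binv g * B).
Proof. by []. Qed.

Lemma mform_sym X Y : mform X Y = mform Y X.
Proof. by rewrite /mform addrC. Qed.

Lemma mform_diag X : mform X X = tr (X * dagger X).
Proof. by rewrite /mform trD; field. Qed.

Lemma mform_bb : bounded_bilinear mform.
Proof.
have lin Y a X X' : mform (a *: X + X') Y = a *: mform X Y + mform X' Y.
  rewrite -[a *: mform X Y]/(a * mform X Y) /mform daggerZD.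
  move: (dagger X) (dagger Y) (dagger X') => u v w.
  rewrite !(mulrDl, mulrDr, bop_scaleAl, bop_scaleAr, trD, trZ).
  by ring.
have [_ [k0 hk0]] := bounded_lin_dagger V.
pose k := `|k0|; have hk X : `|dagger X| <= k * `|X|.
  by rewrite (le_trans (hk0 X))// ler_wpM2r// ler_norm.
have [_ [K0 hK0]] := tr_bl.
pose K := `|K0|; have hK X : `|tr X| <= K * `|X|.
  by rewrite (le_trans (hK0 X))// ler_wpM2r// ler_norm.
split=> [Y a X X'|X a Y Y'|]; first exact: lin.
  by rewrite !(mform_sym X) lin.
exists (K * k) => X Y.
have b X' Y' : `|X' * dagger Y'| <= k * `|X'| * `|Y'|.
  rewrite (le_trans (bop_normM _ _))// (mulrC k) -mulrA ler_wpM2l//.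
rewrite /mform normrM ger0_norm// -mulrA.
have le1 : `|tr (X * dagger Y + Y * dagger X)| <= K * (2 * k * (`|X| * `|Y|)).
  rewrite (le_trans (hK _))// ler_wpM2l//; first exact: normr_ge0.
  rewrite (le_trans (ler_normD _ _))//.
  rewrite (le_trans (lerD (b _ _) (b _ _)))// le_eqVlt.
  by apply/orP; left; apply/eqP; ring.
rewrite (le_trans (ler_wpM2l _ le1))// le_eqVlt.
by apply/orP; left; apply/eqP; field.
Qed.

Lemma mform_str x x' B B' : Der B -> Der B' ->
  mform (Lop x + B) (Lop x' + B') = tr (Lop x * Lop x') - tr (B * B').
Proof.
move=> hB hB'; rewrite /mform !daggerE//.
rewrite !(mulrDl, mulrDr, mulrN, mulNr, trD, trN).
rewrite (trC (Lop x') (Lop x)) (trC B' B) (trC B (Lop x')) (trC B' (Lop x)).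
by field.
Qed.

(** The operator [conn_op X] is skew for the metric: on the summands of str(V) only
    traces of products of three factors occur, and they cancel by cyclicity. *)
Lemma mform_conn_op X Y Z : str_set X -> str_set Y -> str_set Z ->
  mform (conn_op X Y) Z + mform Y (conn_op X Z) = 0.
Proof.
move=> [x [D [hD XE]]] [y [B [hB YE]]] [z [C [hC ZE]]].
have [_ DerD DerZ] := Der_submod_closed V.
have dec u E : Der E -> conn_op X (Lop u + E) =
    Lop (2^-1 *: (3 *: D u + E x)) +
    2^-1 *: (bracket D E + bracket (Lop x) (Lop u)).
  move=> hE; rewrite conn_opE XE !daggerE// LopZ LopD LopZ.
  have -> : Lop (D u) = D * Lop u - Lop u * D by rewrite Der_Lop// addrK.
  have -> : Lop (E x) = E * Lop x - Lop x * E by rewrite Der_Lop// addrK.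
  rewrite /bracket; move: (Lop x) (Lop u) => l a.
  by bop_ring R V.
have derE u E : Der E -> Der (2^-1 *: (bracket D E + bracket (Lop x) (Lop u))).
  by move=> hE; apply: DerZ; apply: DerD; [exact: Der_bracket|exact: Der_bracketL].
rewrite YE ZE !dec// !mform_str//; do ?exact: derE.
have LD E u : Der E -> Lop (E u) = E * Lop u - Lop u * E.
  by move=> hE; rewrite Der_Lop// addrK.
rewrite !(LopZ, LopD) !LD// /bracket.
move: (Lop x) (Lop y) (Lop z) => l a a'.
have mid k u v : tr (u * k * v) = tr (k * v * u) by rewrite -mulrA trC.
have last k u v : tr (u * v * k) = tr (k * u * v) by rewrite trC mulrA.
rewrite !(mulrDl, mulrDr, mulrN, mulNr, bop_scaleAl, bop_scaleAr, trD, trN, trZ, mulrA).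
rewrite !(mid D) !(last D) !(mid l) !(last l).
by field.
Qed.

Lemma metric_compatible (J : set R) (c mu nu : R -> bop V) (t : R) :
  path_in (Str V) J c -> field_along (tangent V) J c mu ->
  field_along (tangent V) J c nu -> J t ->
  derive1 (fun s => str_metric tr (c s) (mu s) (nu s)) t =
  str_metric tr (c t) (Dt V c mu t) (nu t) + str_metric tr (c t) (mu t) (Dt V c nu t).
Proof.
move=> Jc [sm tm] [sn tn] Jt; have [[oJ _] sc cS] := Jc.
have cG := Str_GL (cS t Jt).
have Yd := smooth_is_derive (path_binv_smooth Jc sm) Jt.
have Zd := smooth_is_derive (path_binv_smooth Jc sn) Jt.
rewrite (is_derive_derive1 (is_derive_bilin mform_bb Yd Zd)) !str_metricE.
rewrite (Dt_trivialized Jc sm Jt) (Dt_trivialized Jc sn Jt).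
set X := binv (c t) * derive1 c t; set Y := binv (c t) * mu t.
set Z := binv (c t) * nu t.
have iK A : binv (c t) * (c t * A) = A by rewrite mulrA binvKl// mul1r.
rewrite !iK (bbDl mform_bb) (bbDr mform_bb).
have hX : str_set X by apply/tangentP => //; have [_] := velocity_field Jc; exact.
have hY : str_set Y by apply/tangentP => //; exact: tm.
have hZ : str_set Z by apply/tangentP => //; exact: tn.
rewrite -[LHS]addr0 -(mform_conn_op hX hY hZ).
by ring.
Qed.

End TraceMetric.

Section PositiveDefinite.
Variable R : realType.

Definition posdef n (G : 'M[R]_n) : Prop :=
  G^T = G /\ forall u : 'rV_n, u != 0 -> 0 < (u *m G *m u^T) 0 0.

(** Completing the square in the first coordinate leaves a positive definite form in
    the others, the Schur complement [S]. *)
Lemma posdef_diagonalizable n (G : 'M[R]_n) : posdef G ->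
  exists2 P : 'M[R]_n, P \in unitmx &
  exists2 d : 'rV[R]_n, forall i, 0 < d 0 i & P *m G *m P^T = diag_mx d.
Proof.
elim: n G => [|n IH] G [Gsym Gpos].
  exists 1%:M; first exact: unitmx1.
  by exists 0 => [[]|]//; apply/matrixP => -[].
pose G' : 'M[R]_(1 + n) := G.
have Gpos' (u : 'rV[R]_(1 + n)) : u != 0 -> 0 < (u *m G' *m u^T) 0 0.
  exact: Gpos.
have GsymE : G'^T = G' by exact: Gsym.
pose a : 'M[R]_1 := ulsubmx G'; pose b := ursubmx G'; pose C := drsubmx G'.
have GE : G' = block_mx a b b^T C.
  by rewrite -[LHS]submxK /a /b /C trmx_ursub GsymE.
have aT : a^T = a by rewrite /a trmx_ulsub GsymE.
have CT : C^T = C by rewrite /C trmx_drsub GsymE.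
have a0 : 0 < a 0 0.
  have : row_mx (1%:M : 'M[R]_1) 0 != 0 :> 'rV_(1 + n).
    apply/eqP => /(congr1 lsubmx); rewrite row_mxKl => /matrixP/(_ 0 0).
    by rewrite !mxE /= => /eqP; rewrite oner_eq0.
  move=> /Gpos'; rewrite GE mul_row_block tr_row_mx mul_row_col.
  by rewrite !mul1mx !mul0mx !addr0 trmx0 mulmx0 addr0 trmx1 mulmx1.
pose k := (a 0 0)^-1.
have aE : a = (a 0 0)%:M by exact: mx11_scalar.
pose P1 : 'M[R]_(1 + n) := block_mx 1%:M 0 (- (k *: b^T)) 1%:M.
pose S := C - k *: (b^T *m b).
have P1G : P1 *m G' *m P1^T = block_mx a 0 0 S.
  rewrite GE /P1 tr_block_mx !mulmx_block.
  rewrite !(trmx1, trmx0, mul1mx, mulmx1, mul0mx, mulmx0, addr0, add0r).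
  have kab : - (k *: b^T) *m a + b^T = 0.
    rewrite aE mulNmx -scalemxAl mul_mx_scalar scalerA /k mulVf ?gt_eqF//.
    by rewrite scale1r addNr.
  rewrite kab mul0mx add0r; congr block_mx.
    by rewrite -[RHS]trmx0 -kab linearD /= trmx_mul aT trmxK linearN /=.
  by rewrite mulNmx -scalemxAl addrC.
have Spd : posdef S.
  split; first by rewrite /S linearB /= linearZ /= trmx_mul trmxK CT.
  move=> u u0; pose w : 'rV_(1 + n) := row_mx 0 u *m P1.
  have w0 : w != 0.
    apply: contra u0 => /eqP/(congr1 rsubmx).
    rewrite /w mul_row_block row_mxKr mul0mx add0r mulmx1 => ->.
    by apply/eqP/rowP => i; rewrite !mxE.
  have := Gpos' _ w0.
  have -> : w *m G' *m w^T = row_mx 0 u *m (P1 *m G' *m P1^T) *m (row_mx 0 u)^T.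
    by rewrite /w trmx_mul !mulmxA.
  rewrite P1G mul_row_block tr_row_mx mul_row_col.
  by rewrite !(mul0mx, mulmx0, add0r, addr0).
have [P2 P2u [d d0 P2d]] := IH S Spd.
pose P : 'M[R]_(1 + n) := block_mx 1%:M 0 0 P2 *m P1.
have Pu : P \in unitmx.
  rewrite /P unitmx_mul; apply/andP; split.
    by rewrite unitmxE det_ublock det1 mul1r -unitmxE.
  by rewrite unitmxE /P1 det_lblock !det1 mul1r unitr1.
pose d' : 'rV_(1 + n) := row_mx a d.
have d'0 (i : 'I_(1 + n)) : 0 < d' 0 i.
  rewrite /d' mxE; case: fintype.splitP => j _ //.
  by rewrite ord1.
have PG : P *m G' *m P^T = diag_mx d'; last by exists P => //; exists d'.
have -> : P *m G' *m P^T = block_mx 1%:M 0 0 P2 *m (P1 *m G' *m P1^T)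
    *m (block_mx 1%:M 0 0 P2)^T.
  by rewrite /P trmx_mul !mulmxA.
rewrite P1G tr_block_mx !mulmx_block.
rewrite !(trmx1, trmx0, mul1mx, mulmx1, mul0mx, mulmx0, addr0, add0r).
rewrite P2d /d' diag_mx_row; congr block_mx.
by apply/matrixP => i j; rewrite !ord1 !mxE eqxx.
Qed.

(** B is the adjoint of A for the form G, so the trace is the squared Hilbert-Schmidt
    norm of A, a positive combination of the squares of its entries in a basis that is
    orthogonal for G. *)
Lemma trace_adjoint_gt0 n (G A B : 'M[R]_n) : posdef G ->
  A *m G = G *m B^T -> A != 0 -> 0 < \tr (A *m B).
Proof.
move=> /posdef_diagonalizable[P Pu [d d0 PG]] AB A0.
pose A' := P *m A *m invmx P; pose B' := P *m B *m invmx P.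
have A'B' : A' *m diag_mx d = diag_mx d *m B'^T.
  rewrite -PG /A' /B' !trmx_mul !mulmxA mulmxKV// -(mulmxA P A) AB !mulmxA.
  congr (_ *m _).
  by rewrite -(mulmxA (P *m G)) -trmx_mul mulVmx// trmx1 mulmx1.
have -> : \tr (A *m B) = \tr (A' *m B').
  rewrite /A' /B' !mulmxA mulmxKV// -!mulmxA [RHS]mxtrace_mulC !mulmxA.
  by rewrite mulmxKV.
have ent i j : B' j i = A' i j * d 0 j / d 0 i.
  move/matrixP: A'B' => /(_ i j); rewrite mul_mx_diag mul_diag_mx !mxE => ->.
  by rewrite mulrAC mulfV ?mul1r// gt_eqF.
have -> : \tr (A' *m B') = \sum_i \sum_j A' i j ^+ 2 * (d 0 j / d 0 i).
  apply: eq_bigr => i _; rewrite mxE; apply: eq_bigr => j _; rewrite ent.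
  by rewrite expr2 !mulrA.
have t0 i j : 0 <= A' i j ^+ 2 * (d 0 j / d 0 i).
  by rewrite mulr_ge0 ?sqr_ge0// divr_ge0// ltW.
have A'0 : A' != 0.
  apply: contra A0 => /eqP A'0; apply/eqP.
  have -> : A = invmx P *m A' *m P by rewrite /A' !mulmxA mulVmx// mul1mx mulmxKV.
  by rewrite A'0 mulmx0 mul0mx.
have [i [j Aij]] : exists i j, A' i j != 0.
  apply: contrapT => H; move/eqP: A'0; apply; apply/matrixP => i j.
  rewrite [RHS]mxE; apply/eqP; apply: contrapT => /negP Aij.
  by apply: H; exists i, j.
rewrite (bigD1 i)//= (bigD1 j)//= ltr_pwDl//.
  apply: ltr_pwDl; last by apply: sumr_ge0 => k _.
  by rewrite mulr_gt0 ?divr_gt0// lt_neqAle sqr_ge0 eq_sym sqrf_eq0 Aij.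
by apply: sumr_ge0 => k _; apply: sumr_ge0.
Qed.

End PositiveDefinite.

Section FiniteDimension.
Variables (R : realType) (W : jbAlgType R) (n : nat).
Variables (phi : {linear W -> 'rV[R]_n}) (psi : 'rV[R]_n -> W).
Hypotheses (phiK : cancel phi psi) (psiK : cancel psi phi).

Let psi_linear : linear psi.
Proof.
by move=> a u v; apply: (can_inj phiK); rewrite linearP !psiK.
Qed.

Lemma psi_sum (u : 'rV[R]_n) : psi u = \sum_i u 0 i *: psi (delta_mx 0 i).
Proof.
pose f : {linear 'rV[R]_n -> W} := HB.pack psi
  (GRing.isLinear.Build R 'rV[R]_n W _ psi psi_linear).
rewrite -[LHS]/(f u) {1}(row_sum_delta u) linear_sum.
by apply: eq_bigr => i _; rewrite linearZ.
Qed.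

Lemma coord_norm_le (u : 'rV[R]_n) i : `|u 0 i| <= `|u|.
Proof.
rewrite [leRHS]/Num.norm /= mx_normrE.
exact: (le_bigmax _ (fun ij => `|u ij.1 ij.2|) (0, i)).
Qed.

Let psi_bounded : bounded_lin psi.
Proof.
split=> //; exists (\sum_i `|psi (delta_mx 0 i)|) => u.
rewrite psi_sum (le_trans (ler_norm_sum _ _ _))// mulr_suml ler_sum// => i _.
by rewrite normrZ mulrC ler_wpM2l// coord_norm_le.
Qed.

(** Linear coordinates on a finite-dimensional normed space are bounded, since the
    norm is bounded below on the compact unit sphere of the coordinate space. *)
Lemma coordinates_bounded : exists2 C : R, 0 <= C & forall v, `|phi v| <= C * `|v|.
Proof.
pose S := [set u : 'rV[R]_n | `|u| = 1].
have unit u : u != 0 -> S (`|u|^-1 *: u).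
  by move=> u0; rewrite /S /= normrZ normfV normr_id mulVf// normr_eq0.
have [S0|S0] := pselect (S !=set0); last first.
  exists 0 => // v; rewrite mul0r normr_le0; apply: contrapT => /negP v0.
  by apply: S0; exists (`|phi v|^-1 *: phi v); exact: unit.
have cpsi : continuous (fun u => `|psi u|).
  move=> u; have pu : (psi \o id) @ u --> psi u.
    exact: (@cvg_lin _ _ _ _ psi_bounded _ (nbhs u) (nbhs_filter u) id u (fun P => id)).
  exact: cvg_norm pu.
have Sc : compact S.
  apply: bounded_closed_compact.
    exists 1; split; first exact: num_real.
    by move=> x x1 u /= ->; exact: ltW.
  have -> : S = (fun u : 'rV[R]_n => `|u|) @^-1` [set 1 : R] by [].
  apply: closed_comp; last exact: closed_eq.
  by move=> u _; exact: norm_continuous.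
have [c Sc1 cmin] := EVT_min_rV S0 Sc (continuous_subspaceT cpsi).
have {}Sc1 : S c by rewrite inE in Sc1.
have m0 : 0 < `|psi c|.
  rewrite normr_gt0; apply/negP => /eqP pc0.
  have c0 : c = 0 by rewrite -(psiK c) pc0 linear0.
  by move: Sc1; rewrite /S /= c0 normr0 => /eqP; rewrite eq_sym oner_eq0.
exists (`|psi c|^-1) => [|v]; first by rewrite invr_ge0.
have [->|pv0] := eqVneq (phi v) 0; first by rewrite normr0 mulr_ge0// invr_ge0.
have npv : 0 < `|phi v| by rewrite normr_gt0.
have := cmin _ (mem_set (unit _ pv0)).
have -> : psi (`|phi v|^-1 *: phi v) = `|phi v|^-1 *: v.
  by apply: (can_inj phiK); rewrite psiK linearZ.
rewrite normrZ normfV normr_id mulrC ler_pdivlMr// => h.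
by rewrite mulrC ler_pdivlMr// mulrC.
Qed.

Local Notation tr := (op_trace phi psi).

Definition opmx (A : bop W) : 'M[R]_n := lin1_mx (fun u => phi (A (psi u))).

Lemma opmxE (A : bop W) u : u *m opmx A = phi (A (psi u)).
Proof.
have fl : linear (fun u => phi (A (psi u))).
  by move=> a v w; rewrite psi_linear bop_linear linearP.
pose f : {linear 'rV[R]_n -> 'rV[R]_n} := HB.pack (fun u => phi (A (psi u)))
  (GRing.isLinear.Build R 'rV[R]_n 'rV[R]_n _ _ fl).
exact: (mul_rV_lin1 f).
Qed.

Lemma opmxM A B : opmx (A * B) = opmx B *m opmx A.
Proof.
by apply/row_matrixP => i; rewrite !rowE mulmxA !opmxE phiK.
Qed.

Lemma opmx_inj A : opmx A = 0 -> A = 0.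
Proof.
move=> A0; apply: bopE => v; apply: (can_inj phiK).
by have := opmxE A (phi v); rewrite A0 mulmx0 phiK bop0E linear0.
Qed.

Lemma op_trace_mulC A B : tr (A * B) = tr (B * A).
Proof. by rewrite /op_trace -!/(opmx _) !opmxM mxtrace_mulC. Qed.

Lemma op_trace_bounded : bounded_lin tr.
Proof.
split.
  move=> a A B; rewrite /op_trace -!/(opmx _).
  have -> : opmx (a *: A + B) = a *: opmx A + opmx B.
    apply/row_matrixP => i; rewrite !rowE mulmxDr -scalemxAr !opmxE.
    by rewrite bopDE bopZE linearP.
  by rewrite mxtraceD mxtraceZ.
have [C C0 hC] := coordinates_bounded.
exists (\sum_i C * `|psi (delta_mx 0 i)|) => A.
rewrite /op_trace /mxtrace (le_trans (ler_norm_sum _ _ _))// mulr_suml ler_sum// => i _.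
rewrite mxE (le_trans (coord_norm_le _ _))// (le_trans (hC _))//.
rewrite -mulrA ler_wpM2l// mulrC bop_normP//.
Qed.

End FiniteDimension.

Section TracePositivity.
Variables (R : realType) (V : jbAlgType R) (n : nat).
Variables (phi : {linear V -> 'rV[R]_n}) (psi : 'rV[R]_n -> V).
Hypotheses (phiK : cancel phi psi) (psiK : cancel psi phi).

Local Notation tr := (op_trace phi psi).
Hypothesis tr_pos : forall v, v != 0 -> 0 < trace_form tr v v.

(** [dagger X] is the adjoint of X for the trace form, whose Gram matrix in the given
    coordinates is positive definite. *)
Lemma trace_str_gt0 (X : bop V) : str_set X -> X != 0 -> 0 < tr (X * dagger X).
Proof.
move=> hX X0; have tr_bl := op_trace_bounded phiK psiK.
have trC := op_trace_mulC phiK psiK.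
pose f v w := trace_form tr v w.
have fC v w : f v w = f w v by rewrite /f /trace_form jmulC.
have fl w a u v : f (a *: u + v) w = a * f u w + f v w.
  by rewrite /f /trace_form jmulDl jmulZl LopD LopZ trD// trZ.
pose G : 'M[R]_n := \matrix_(i, j) f (psi (delta_mx 0 i)) (psi (delta_mx 0 j)).
have f0 w : f 0 w = 0 by have := fl w (-1) 0 0; rewrite scaler0 addr0 mulN1r addNr.
have fsum w (u : 'rV[R]_n) : f (psi u) w = \sum_i u 0 i * f (psi (delta_mx 0 i)) w.
  rewrite (psi_sum phiK psiK).
  elim/big_ind2: _ => [|a b a' b' ha hb|i _]; first exact: f0.
    by have := fl w 1 b b'; rewrite scale1r mul1r ha hb.
  by have := fl w (u 0 i) (psi (delta_mx 0 i)) 0; rewrite !addr0 f0 addr0.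
have fG (u v : 'rV[R]_n) : f (psi u) (psi v) = (u *m G *m v^T) 0 0.
  rewrite fsum -mulmxA mxE; apply: eq_bigr => i _; congr (_ * _).
  rewrite fC fsum mxE; apply: eq_bigr => j _.
  by rewrite !mxE fC mulrC.
have Gpos : posdef G.
  split; first by apply/matrixP => i j; rewrite !mxE fC.
  move=> u u0; rewrite -fG; apply: tr_pos.
  apply: contra u0 => /eqP pu0; apply/eqP.
  by rewrite -(psiK u) pu0 linear0.
rewrite trC /op_trace -/(opmx phi psi _) (opmxM phiK psiK).
apply: (trace_adjoint_gt0 Gpos).
  apply/matrixP => i j.
  have e (A : 'M[R]_n) (k l : 'I_n) :
      A k l = ((delta_mx 0 k : 'rV_n) *m A *m (delta_mx 0 l : 'rV_n)^T) 0 0.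
    by rewrite -rowE trmx_delta -colE !mxE.
  rewrite e [RHS]e.
  move: (delta_mx 0 i : 'rV[R]_n) (delta_mx 0 j : 'rV[R]_n) => u v.
  rewrite (mulmxA u (opmx _ _ _)) [RHS](_ : _ =
    (u *m G *m (v *m opmx phi psi (dagger X))^T) 0 0); last first.
    by rewrite trmx_mul !mulmxA.
  rewrite -!fG !(opmxE phiK psiK) !phiK /f.
  exact: trace_form_adjoint.
by apply: contra X0 => /eqP /(opmx_inj phiK psiK) ->.
Qed.

End TracePositivity.

(** * The theorem *)

Theorem mainTheorem1 (R : realType) (V : jbAlgType R) :
  [/\ torsion_free_covariant_derivative (Str V) (tangent V)
        (Christoffel V) (Dt V),
      (* (a) *)
      forall (y : V) (D : bop V) (g : bop V), Der D -> Str V g ->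
        let W : bop V := Lop y + D in
        let c : R -> bop V :=
          fun t => g * bexp (t *: (Lop y - D)) * bexp ((2 * t) *: D) in
        [/\ geodesic_from (Str V) (Dt V) setT c g (g * W),
            forall (J : set R) (s : R -> bop V),
              geodesic_from (Str V) (Dt V) J s g (g * W) ->
              forall t, J t -> s t = c t &
            forall t, geodesic_exp (Str V) (Dt V) g (t *: (g * W)) = c t],
      (* (b) *)
      forall (y : V) (D : bop V) (hD : Der D) (g : bop V), Str V g ->
        let c : R -> bop V :=
          fun t => g * bexp (t *: (Lop y - D)) * bexp ((2 * t) *: D) in
        let l := str_L y in
        let d := str_D hD in
        let M := transport_op l d in
        forall (mu0 : bop V) (Z0 : str V),
          tangent V g mu0 -> str_val Z0 = binv g * mu0 ->
          let mu : R -> bop V := fun t =>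
            c t * str_val (bexp (- (2 * t) *: ad d) (bexp (t *: M) Z0)) in
          [/\ parallel (tangent V) (Dt V) setT c mu,
              mu 0 = mu0 &
              forall (J : set R) (nu : R -> bop V),
                open_interval J -> J 0 ->
                parallel (tangent V) (Dt V) J c nu -> nu 0 = mu0 ->
                forall t, J t -> nu t = mu t] &
      (* (c) *)
      forall (n : nat) (phi : {linear V -> 'rV[R]_n}) (psi : 'rV[R]_n -> V),
        cancel phi psi -> cancel psi phi ->
        is_inner_product (trace_form (op_trace phi psi)) ->
        let q := str_metric (op_trace phi psi) in
        [/\ Riemannian_metric (Str V) (tangent V) q,
            forall h g A B : bop V, Str V h -> Str V g ->
              tangent V g A -> tangent V g B -> q (h * g) (h * A) (h * B) = q g A B &
            Levi_Civita (Str V) (tangent V) q (Christoffel V) (Dt V)]].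
Proof.
have TF := Dt_torsion_free V.
split=> //.
- move=> y D g hD hg W c.
  have geo := exp_geodesic y hD hg.
  have cE : c = (fun t => g * bexp (t *: (Lop y - D)) * bexp (t *: (2 *: D))).
    by apply/funext => t; rewrite /c scalerA (mulrC t).
  split=> //.
    by move=> J s /(geodesic_unique hD hg) h t /h ->; rewrite cE.
  move=> t.
  have [_ _ DerZ] := Der_submod_closed V; have htD := DerZ t _ hD.
  have tW : t *: (g * W) = g * (Lop (t *: y) + t *: D).
    by rewrite LopZ -scalerDr bop_scaleAr.
  (* At time 1 the geodesic with initial velocity t (g W) reaches c t. *)
  have c1 : g * bexp (1 *: (Lop (t *: y) - t *: D)) * bexp (1 *: (2 *: (t *: D))) = c t.
    by rewrite cE !scale1r LopZ -scalerBr !scalerA (mulrC t).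
  rewrite /geodesic_exp; apply: xget_subset1.
    exists setT, (fun u : R => g * bexp (u *: (Lop (t *: y) - t *: D))
      * bexp ((2 * u) *: (t *: D))); split; [|exact: I|].
      by rewrite tW; exact: exp_geodesic.
    by rewrite -c1 mulr1 !scale1r.
  move=> a b [J [s [gs J1 <-]]] [J' [s' [gs' J'1 <-]]].
  rewrite tW in gs gs'.
  by rewrite (geodesic_unique htD hg gs J1) (geodesic_unique htD hg gs' J'1).
- move=> y D hD g hg c l d M mu0 Z0 _ Z0E mu.
  have cE : c = (fun t => g * bexp (t *: (Lop y - D)) * bexp (t *: (2 *: D))).
    by apply/funext => t; rewrite /c scalerA (mulrC t).
  by have := parallel_exp y hD hg Z0E; rewrite /mu cE.
move=> n phi psi phiK psiK [_ _ pos] q.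
have tr_bl := op_trace_bounded phiK psiK.
have trC := op_trace_mulC phiK psiK.
set tr := op_trace phi psi in tr_bl trC q pos *.
have mbb := mform_bb tr_bl.
split.
- split.
  + by move=> g A B _ _ _; rewrite /q !str_metricE mform_sym.
  + move=> g a A B C _ _ _ _; rewrite /q !str_metricE mulrDr bop_scaleAr.
    by rewrite (bbDl mbb) (bbZl mbb).
  + move=> g A hg tA A0; have gG := Str_GL hg.
    have /(tangentP _ gG) hX := tA.
    rewrite /q str_metricE mform_diag//; apply: trace_str_gt0 => //.
    by apply: contra A0 => /eqP X0; rewrite -[A]mul1r -(binvK gG) -mulrA X0 mulr0.
  + move=> J c mu nu Jc [sm _] [sn _] k.
    have [[oJ _] _ _] := Jc.
    by apply: (Cn_bilin mbb) => //; exact: path_binv_smooth.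
- move=> h g A B hh hg _ _; have [hG gG] := (Str_GL hh, Str_GL hg).
  by rewrite /q !str_metricE binvM// !mul_cancel2// binvKl.
split=> // J c mu nu t Jc fm fn Jt.
exact: (metric_compatible tr_bl trC Jc fm fn Jt).
Qed.
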